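(* Let $G$ be a group with a finite presentation $\langle x_1,\dots,x_n\mid r_1,\dots,r_m\rangle$, let $K=K_G$ be the associated presentation $2$-complex, and let $b=b_1(G)$. Let $G_e=\langle x_1,\dots,x_n\mid w_1,\dots,w_m\rangle$ be an echelon approximation of this presentation, let $\kappa$ be the Magnus expansion of $G_e$, and let $\{u_1,\dots,u_b\}$ and $\{\beta_{n-b+1},\dots,\beta_m\}$ be the transferred bases of $H^1(K;\mathbb{Q})$ and $H^2(K;\mathbb{Q})$ described in the context. Then the cup-product map $\mu_K\colon H^1(K;\mathbb{Q})\wedge H^1(K;\mathbb{Q})\to H^2(K;\mathbb{Q})$ is given by \[ u_i\cup u_j=\sum_{k=n-b+1}^{m}\kappa(w_k)_{i,j}\,\beta_k,\qquad 1\le i,j\le b . \]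
   Context: Let $F$ be the free group on $x_1,\dots,x_n$. The Magnus expansion $M\colon \mathbb{Q}F\to \widehat T(F_{\mathbb{Q}})=\mathbb{Q}\langle\langle x_1,\dots,x_n\rangle\rangle$ (power series in non-commuting variables, $F_{\mathbb{Q}}=H_1(F;\mathbb{Q})$) is the ring morphism with $M(x_i)=1+x_i$. For $w\in F$, $\varepsilon_i(w)$ is the coefficient of $x_i$ in $M(w)$, i.e. the exponent sum of $x_i$ in $w$. The presentation $2$-complex $K_G$ has one $0$-cell, $1$-cells $e^1_1,\dots,e^1_n$ corresponding to the generators, and $2$-cells corresponding to the relators, oriented so that in the cellular chain complex of the universal cover $\tilde d_2$ of the $2$-cell of $r_k$ is $\sum_i\varphi(\partial_i r_k)\tilde e^1_i$, where $\varphi\colon \mathbb{Z}F\to\mathbb{Z}G$ is the projection and $\partial_i$ are the Fox derivatives ($\mathbb{Z}$-linear, $\partial_i x_j=\delta_{ij}$, $\partial_i(uv)=\partial_i(u)\varepsilon(v)+u\,\partial_i(v)$, with $\varepsilon$ the augmentation). Cup products of degree-one classes follow the convention $(u\cup u')[g_1|g_2]=u(g_1)u'(g_2)$ in the bar construction. Echelon approximation: choose an invertible integer matrix $C=(c_{l,k})\in \mathrm{GL}(m;\mathbb{Z})$ such that the words $w_k=r_1^{c_{1,k}}r_2^{c_{2,k}}\cdots r_m^{c_{m,k}}$, $1\le k\le m$, have the property that the $m\times n$ matrix $(\varepsilon_i(w_k))$ (row index $k$, column index $i$) is in row-echelon form; such a $C$ exists. Put $G_e=\langle x_1,\dots,x_n\mid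 w_1,\dots,w_m\rangle$. There is a cellular map $f\colon K_{G_e}\to K_G$ which matches $1$-cells on the $1$-skeleta and induces the matrix $C$ on cellular $2$-chains; $f$ induces isomorphisms in homology and cohomology. Let $d=n-b$ be the rank of $(\varepsilon_i(w_k))$, let $i_1<\dots<i_d$ be its pivot columns and $i_{d+1}<\dots<i_n$ the remaining column indices. Then $H_1(K_{G_e};\mathbb{Q})\cong H_1(K_G;\mathbb{Q})=H_1(G;\mathbb{Q})$ has basis $y_1,\dots,y_b$, with $y_j$ the class of $e^1_{i_{d+j}}$; $\{u_1,\dots,u_b\}$ is the dual basis of $H^1(K_G;\mathbb{Q})$. Let $z_1,\dots,z_m$ be the basis of $C_2(K_G;\mathbb{Q})$ given by the $2$-cells of $r_1,\dots,r_m$, and set $\gamma_k=\sum_{l=1}^m c_{l,k}z_l$ (the image under $f_*$ of the $2$-cell of $w_k$). Then $\{\gamma_{d+1},\dots,\gamma_m\}$ is a basis of $H_2(K_G;\mathbb{Q})$, and $\{\beta_{d+1},\dots,\beta_m\}$ is the dual basis of $H^2(K_G;\mathbb{Q})$. Let $\pi\colon F_{\mathbb{Q}}\to H_1(G_e;\mathbb{Q})\cong H_1(G;\mathbb{Q})$ be the induced projection. The Magnus expansion $\kappa$ of $G_e$ is $\kappa=\widehat T(\pi)\circ M\colon \mathbb{Q}F\to \widehat T(H_1(G_e;\mathbb{Q}))=\mathbb{Q}\langle\langle y_1,\dots,y_b\rangle\rangle$, and $\kappa(w)_{i,j}$ denotes the coefficient of $y_iy_j$ in $\kappa(w)$. 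*)

(* Defs.v *)
From HB Require Import structures.
From mathcomp Require Import all_boot all_order all_algebra.
From mathcomp Require Import boolp classical_sets.
From mathcomp.multinomials Require Import freeg.

Set Implicit Arguments.
Unset Strict Implicit.
Unset Printing Implicit Defensive.

Import GRing.Theory Num.Theory.
Local Open Scope ring_scope.

(* [(i, true)] is the letter x_i and [(i, false)] is x_i^-1; elements of the
   free group are the freely reduced words. *)
Section FreeGroup.
Variable I : choiceType.
Local Notation letter := (I * bool)%type.
Implicit Types (a b : letter) (u v w : seq letter).

Definition linv a : letter := (a.1, ~~ a.2).

Definition fg_reduced w := sorted (fun a b => b != linv a) w.

Definition fg_push a w :=
  if w is b :: w' then if b == linv a then w' else a :: w else [:: a].

Definition fg_reduce w := foldr fg_push [::] w.

Record free_group :=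
  FreeGroup { fg_word :> seq letter; _ : fg_reduced fg_word }.

HB.instance Definition _ := [isSub for fg_word].
HB.instance Definition _ := [Choice of free_group by <:].

Lemma linvK a : linv (linv a) = a.
Proof. by case: a => i c; rewrite /linv /= negbK. Qed.

Lemma fg_push_reduced a w : fg_reduced w -> fg_reduced (fg_push a w).
Proof.
case: w => [|b w] //=; case: ifP => [_|/negbT ne_ba]; first exact: path_sorted.
by rewrite /= ne_ba.
Qed.

Lemma fg_reduce_reduced w : fg_reduced (fg_reduce w).
Proof. by elim: w => //= a w IHw; apply: fg_push_reduced. Qed.

Lemma fg_reduce_id w : fg_reduced w -> fg_reduce w = w.
Proof.
elim: w => //= a w IHw red_aw; rewrite IHw; last exact: path_sorted red_aw.
by case: w {IHw} red_aw => //= b w /andP[/negPf-> _].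
Qed.

Lemma fg_pushK a w : fg_reduced w -> fg_push (linv a) (fg_push a w) = w.
Proof.
case: w => [|b w] /= red_w; first by rewrite linvK eqxx.
case: eqVneq => [eq_b|ne_b] /=; last by rewrite linvK eqxx.
rewrite {}eq_b in red_w *; case: w red_w => //= c w.
by rewrite linvK => /andP[/negPf->].
Qed.

Lemma fg_reduce_cat u v : fg_reduce (u ++ v) = foldr fg_push (fg_reduce v) u.
Proof. by rewrite /fg_reduce foldr_cat. Qed.

Lemma foldr_fg_push_reduced u v :
  fg_reduced v -> fg_reduced (foldr fg_push v u).
Proof. by move=> red_v; elim: u => //= a u; apply: fg_push_reduced. Qed.

Lemma foldr_fg_push u v :
  fg_reduced v -> foldr fg_push v (fg_reduce u) = foldr fg_push v u.
Proof.
move=> red_v; elim: u => //= a u <-.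
case: (fg_reduce u) => //= b w; case: ifP => //= /eqP->.
by rewrite -{1}[a]linvK fg_pushK // foldr_fg_push_reduced.
Qed.

Lemma fg_reduce_catl u v : fg_reduce (fg_reduce u ++ v) = fg_reduce (u ++ v).
Proof. by rewrite !fg_reduce_cat foldr_fg_push ?fg_reduce_reduced. Qed.

Lemma fg_reduce_catr u v : fg_reduce (u ++ fg_reduce v) = fg_reduce (u ++ v).
Proof.
rewrite !fg_reduce_cat [fg_reduce (fg_reduce v)]fg_reduce_id //.
exact: fg_reduce_reduced.
Qed.

Definition fg_of w := FreeGroup (fg_reduce_reduced w).
Definition fg_one := fg_of [::].
Definition fg_mul (g h : free_group) := fg_of (g ++ h).
Definition fg_inv (g : free_group) := fg_of (rev (map linv g)).

Lemma fg_wordK (g : free_group) : fg_reduce g = g.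
Proof. by case: g => w red_w; apply: fg_reduce_id. Qed.

Lemma fg_mulA : associative fg_mul.
Proof.
move=> f g h; apply: val_inj.
by rewrite /= fg_reduce_catl fg_reduce_catr catA.
Qed.

Lemma fg_mul1 : left_id fg_one fg_mul.
Proof. by move=> g; apply: val_inj; rewrite /= fg_wordK. Qed.

Lemma fg_mulr1 : right_id fg_one fg_mul.
Proof. by move=> g; apply: val_inj; rewrite /= cats0 fg_wordK. Qed.

Lemma fg_reduceVw w : fg_reduce (rev (map linv w) ++ w) = [::].
Proof.
elim: w => //= a w IHw; rewrite rev_cons -cats1 -catA /= -fg_reduce_catr /=.
by rewrite fg_pushK ?fg_reduce_reduced // fg_reduce_catr.
Qed.

Lemma fg_mulV : left_inverse fg_one fg_inv fg_mul.
Proof. by move=> g; apply: val_inj; rewrite /= fg_reduce_catl fg_reduceVw. Qed.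

Lemma fg_mulrV : right_inverse fg_one fg_inv fg_mul.
Proof.
move=> g; apply: val_inj; rewrite /= fg_reduce_catr.
have := fg_reduceVw (rev (map linv g)).
by rewrite map_rev revK -map_comp map_id_in // => a _; apply: linvK.
Qed.

HB.instance Definition _ :=
  isGroup.Build free_group fg_mulA fg_mul1 fg_mulr1 fg_mulV fg_mulrV.

Definition fg_gen (i : I) : free_group := fg_of [:: (i, true)].

End FreeGroup.

Notation "''FG_' n" := (free_group 'I_n)
  (at level 8, n at level 2, format "''FG_' n") : type_scope.

Section FreegLift.
Variables (R : nzRingType) (K : choiceType) (M : lmodType R) (f : K -> M).

HB.instance Definition _ :=
  GRing.isZmodMorphism.Build {freeg K / R} M (fglift f)
    (@lift_is_additive R K M f).

Lemma fgliftE x : fglift f x = \sum_(k <- dom x) coeff k x *: f k.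
Proof.
rewrite -{1}[x]freeg_sumE raddf_sum.
by apply: eq_bigr => k _; rewrite /= liftU.
Qed.

Lemma fglift_is_scalable : scalable (fglift f).
Proof.
move=> c x; rewrite [in RHS]fgliftE scaler_sumr.
rewrite [c *: x]/(fgscale c x) /fgscale raddf_sum.
by apply: eq_bigr => k _; rewrite /= liftU scalerA.
Qed.

HB.instance Definition _ :=
  GRing.isScalable.Build R {freeg K / R} M *:%R (fglift f) fglift_is_scalable.

End FreegLift.

Section GroupRing.
Variable G : groupType.

Definition grpring : Type := {freeg G / int}.

HB.instance Definition _ := GRing.Lmodule.copy grpring {freeg G / int}.

Definition gr_one : grpring := << 1%g >>.
Definition gr_mul (x y : grpring) : grpring :=
  fglift (fun g : G => fglift (fun h : G => << (g * h)%g >> : grpring) y) x.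

Lemma freeg_scaleU (k : int) (g : G) : << k *g g >> = k *: << g >> :> grpring.
Proof.
apply/eqP/freeg_eqP => h.
by rewrite coeffZ !coeffU mul1r.
Qed.

Lemma grpring_sumE (x : grpring) : x = \sum_(g <- dom x) coeff g x *: << g >>.
Proof.
by rewrite -{1}[x]freeg_sumE; apply: eq_bigr => g _; rewrite freeg_scaleU.
Qed.

Lemma gr_mulDl : left_distributive gr_mul +%R.
Proof. by move=> x y z; rewrite /gr_mul raddfD. Qed.

Lemma gr_mulDr : right_distributive gr_mul +%R.
Proof.
move=> x y z; rewrite /gr_mul !fgliftE -big_split /=.
by apply: eq_bigr => g _; rewrite raddfD scalerDr.
Qed.

Lemma gr_mul_suml (J : Type) (s : seq J) (F : J -> grpring) y :
  gr_mul (\sum_(j <- s) F j) y = \sum_(j <- s) gr_mul (F j) y.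
Proof. by rewrite /gr_mul raddf_sum. Qed.

Lemma gr_mul_sumr (J : Type) (s : seq J) (F : J -> grpring) x :
  gr_mul x (\sum_(j <- s) F j) = \sum_(j <- s) gr_mul x (F j).
Proof.
apply: (big_morph (gr_mul x) (gr_mulDr x)).
by rewrite /gr_mul fgliftE big1 // => g _; rewrite raddf0 scaler0.
Qed.

Lemma gr_mulZl k x y : gr_mul (k *: x) y = k *: gr_mul x y.
Proof. by rewrite /gr_mul linearZ. Qed.

Lemma gr_mulZr k x y : gr_mul x (k *: y) = k *: gr_mul x y.
Proof.
rewrite /gr_mul !fgliftE scaler_sumr; apply: eq_bigr => g _.
rewrite scalerA mulrC -scalerA; congr (_ *: _).
by rewrite linearZ.
Qed.

Lemma gr_mulU g h : gr_mul << g >> << h >> = << (g * h)%g >>.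
Proof. by rewrite /gr_mul !liftU !scale1r. Qed.

Lemma gr_mulA : associative gr_mul.
Proof.
move=> x y z; rewrite [x]grpring_sumE !gr_mul_suml; apply: eq_bigr => g _.
rewrite !gr_mulZl; congr (_ *: _).
rewrite [y]grpring_sumE !(gr_mul_suml, gr_mul_sumr); apply: eq_bigr => h _.
rewrite !(gr_mulZl, gr_mulZr); congr (_ *: _).
rewrite [z]grpring_sumE !gr_mul_sumr; apply: eq_bigr => k _.
by rewrite !(gr_mulZl, gr_mulZr, gr_mulU) mulgA.
Qed.

Lemma gr_mul1 : left_id gr_one gr_mul.
Proof.
move=> x; rewrite [x]grpring_sumE gr_mul_sumr; apply: eq_bigr => g _.
by rewrite gr_mulZr gr_mulU mul1g.
Qed.

Lemma gr_mulr1 : right_id gr_one gr_mul.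
Proof.
move=> x; rewrite [x]grpring_sumE gr_mul_suml; apply: eq_bigr => g _.
by rewrite gr_mulZl gr_mulU mulg1.
Qed.

Lemma gr_one_neq0 : gr_one != 0.
Proof. by rewrite freegU_eq0. Qed.

HB.instance Definition _ := GRing.Zmodule_isNzRing.Build grpring
  gr_mulA gr_mul1 gr_mulr1 gr_mulDl gr_mulDr gr_one_neq0.

Definition gr_of (g : G) : grpring := << g >>.

Lemma gr_of1 : gr_of 1%g = 1.
Proof. by []. Qed.

Lemma gr_ofM g h : gr_of (g * h)%g = gr_of g * gr_of h.
Proof. by apply: esym; apply: gr_mulU. Qed.

End GroupRing.

(* A series is the family of its coefficients, indexed by the words in the
   variables. *)
Section NCSeries.
Variable I : finType.
Implicit Types (f g h : seq I -> rat) (s : seq I) (a i : I).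

Definition ncseries : Type := seq I -> rat.

HB.instance Definition _ := gen_eqMixin ncseries.
HB.instance Definition _ := gen_choiceMixin ncseries.

Definition ncs_zero : ncseries := fun=> 0.
Definition ncs_opp (f : ncseries) : ncseries := fun s => - f s.
Definition ncs_add (f g : ncseries) : ncseries := fun s => f s + g s.
Definition ncs_one : ncseries := fun s => (s == [::])%:R.
Definition ncs_mul (f g : ncseries) : ncseries :=
  fun s => \sum_(k < (size s).+1) f (take k s) * g (drop k s).

Lemma ncs_addA : associative ncs_add.
Proof. by move=> f g h; apply/funext => s; apply: addrA. Qed.
Lemma ncs_addC : commutative ncs_add.
Proof. by move=> f g; apply/funext => s; apply: addrC. Qed.
Lemma ncs_add0 : left_id ncs_zero ncs_add.
Proof. by move=> f; apply/funext => s; apply: add0r. Qed.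
Lemma ncs_addN : left_inverse ncs_zero ncs_opp ncs_add.
Proof. by move=> f; apply/funext => s; apply: addNr. Qed.

HB.instance Definition _ := GRing.isZmodule.Build ncseries
  ncs_addA ncs_addC ncs_add0 ncs_addN.

Lemma ncs_mul_nil f g : ncs_mul f g [::] = f [::] * g [::].
Proof. by rewrite /ncs_mul big_ord_recl big_ord0 addr0. Qed.

Lemma ncs_mul_cons f g a s :
  ncs_mul f g (a :: s) = f [::] * g (a :: s) + ncs_mul (fun t => f (a :: t)) g s.
Proof. by rewrite /ncs_mul big_ord_recl. Qed.

Lemma ncs_mulDl : left_distributive ncs_mul ncs_add.
Proof.
move=> f g h; apply/funext => s; rewrite /ncs_add /ncs_mul -big_split.
by apply: eq_bigr => k _; rewrite mulrDl.
Qed.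

Lemma ncs_mulDr : right_distributive ncs_mul ncs_add.
Proof.
move=> f g h; apply/funext => s; rewrite /ncs_add /ncs_mul -big_split.
by apply: eq_bigr => k _; rewrite mulrDr.
Qed.

Lemma ncs_mulZl (c : rat) f g s :
  ncs_mul (fun t => c * f t) g s = c * ncs_mul f g s.
Proof.
by rewrite /ncs_mul mulr_sumr; apply: eq_bigr => k _; rewrite mulrA.
Qed.

Lemma ncs_mulA : associative ncs_mul.
Proof.
move=> f g h; apply/funext => s; elim: s f g h => [|a s IHs] f g h.
  by rewrite !ncs_mul_nil mulrA.
rewrite !ncs_mul_cons IHs ncs_mul_nil.
have ->: (fun t => ncs_mul f g (a :: t)) =
    ncs_add (fun t => f [::] * g (a :: t)) (ncs_mul (fun t => f (a :: t)) g).
  by apply/funext => t; rewrite ncs_mul_cons.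
by rewrite ncs_mulDl /ncs_add ncs_mulZl mulrDr mulrA addrA.
Qed.

Lemma ncs_mul1 : left_id ncs_one ncs_mul.
Proof.
move=> f; apply/funext => s; rewrite /ncs_mul big_ord_recl /ncs_one.
rewrite take0 drop0 mul1r big1 ?addr0 // => k _.
by case: s k => [[]//|a s] k; rewrite mul0r.
Qed.

Lemma ncs_mulr1 : right_id ncs_one ncs_mul.
Proof.
move=> f; apply/funext => s; elim: s f => [|a s IHs] f.
  by rewrite ncs_mul_nil mulr1.
by rewrite ncs_mul_cons IHs mulr0 add0r.
Qed.

Lemma ncs_one_neq0 : ncs_one != ncs_zero.
Proof. by apply/eqP => /(congr1 (fun f : ncseries => f [::])) /eqP. Qed.

HB.instance Definition _ := GRing.Zmodule_isNzRing.Build ncseries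
  ncs_mulA ncs_mul1 ncs_mulr1 ncs_mulDl ncs_mulDr ncs_one_neq0.

Definition ncs_var i : ncseries := fun s => (s == [:: i])%:R.

(* 1 - x_i + x_i^2 - ... *)
Definition ncs_geom i : ncseries :=
  fun s => if all (pred1 i) s then (-1) ^+ size s else 0.

Lemma ncs_varM i f s :
  ncs_mul (ncs_var i) f s = if s is a :: t then (a == i)%:R * f t else 0.
Proof.
case: s => [|a s]; first by rewrite ncs_mul_nil mul0r.
rewrite ncs_mul_cons mul0r add0r.
have ->: (fun t => ncs_var i (a :: t)) = (fun t => (a == i)%:R * ncs_one t).
  by apply/funext => t; rewrite /ncs_var /ncs_one eqseq_cons; case: (a == i);
     rewrite ?mul1r ?mul0r.
by rewrite ncs_mulZl ncs_mul1.
Qed.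

Lemma ncs_addE (f g : ncseries) s : (f + g) s = f s + g s.
Proof. by []. Qed.

Lemma ncs_mulE (f g : ncseries) s : (f * g) s = ncs_mul f g s.
Proof. by []. Qed.

Lemma ncs_oneE s : (1 : ncseries) s = (s == [::])%:R.
Proof. by []. Qed.

Lemma ncs_geomS i a s :
  ncs_geom i (a :: s) = - (a == i)%:R * ncs_geom i s.
Proof.
rewrite /ncs_geom /=; case: (a == i) => /=; last by rewrite oppr0 mul0r.
by case: all; rewrite ?mulr0 // exprS.
Qed.

Lemma ncs_geomV i : (1 + ncs_var i) * ncs_geom i = 1 :> ncseries.
Proof.
rewrite mulrDl mul1r; apply/funext => s.
rewrite ncs_addE ncs_mulE ncs_varM ncs_oneE.
case: s => [|a s]; first by rewrite addr0.
by rewrite ncs_geomS mulNr addNr.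
Qed.

Lemma ncs_geomK i : ncs_geom i * (1 + ncs_var i) = 1 :> ncseries.
Proof.
rewrite mulrDr mulr1; apply/funext => s.
rewrite ncs_addE ncs_mulE ncs_oneE; elim: s => [|a s IHs].
  by rewrite ncs_mul_nil mulr0 addr0.
have geomS : (fun t => ncs_geom i (a :: t)) =
    (fun t => - (a == i)%:R * ncs_geom i t).
  by apply/funext => t; rewrite ncs_geomS.
rewrite ncs_geomS ncs_mul_cons geomS ncs_mulZl addrCA -mulrDr IHs.
rewrite [ncs_geom i [::]]/= mul1r /ncs_var eqseq_cons.
by case: (a == i); case: (s == [::]).
Qed.

End NCSeries.

Section Magnus.
Variable I : finType.
Implicit Types (g h : free_group I).

Definition magnus_letter (a : I * bool) : ncseries I :=
  if a.2 then 1 + ncs_var a.1 else ncs_geom a.1.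

Definition magnus g : ncseries I := \prod_(a <- fg_word g) magnus_letter a.

Lemma magnus_letterV a : magnus_letter a * magnus_letter (linv a) = 1.
Proof.
by case: a => i [] /=; rewrite /magnus_letter /= (ncs_geomV, ncs_geomK).
Qed.

Lemma magnus_reduce (w : seq (I * bool)) :
  \prod_(a <- fg_reduce w) magnus_letter a = \prod_(a <- w) magnus_letter a.
Proof.
elim: w => //= a w IHw; rewrite big_cons -IHw.
case: (fg_reduce w) => [|b v] /=; first by rewrite big_cons.
case: eqVneq => [->|_]; last by rewrite big_cons.
by rewrite big_cons mulrA magnus_letterV mul1r.
Qed.

Lemma magnusM g h : magnus (g * h)%g = magnus g * magnus h.
Proof. by rewrite /magnus magnus_reduce big_cat. Qed.

Lemma magnus1 : magnus 1%g = 1.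
Proof. by rewrite /magnus big_nil. Qed.

Lemma magnus_gen i : magnus (fg_gen i) = 1 + ncs_var i.
Proof. by rewrite /magnus big_seq1. Qed.

Definition exponent_sum (i : I) g : rat := magnus g [:: i].

End Magnus.

(* The morphism of completed tensor algebras induced by the linear map that
   sends x_i to \sum_j P i j y_j. *)
Definition tensor_map n b (P : 'M[rat]_(n, b)) (f : ncseries 'I_n) :
    ncseries 'I_b :=
  fun s => \sum_(t : (size s).-tuple 'I_n)
    f t * \prod_(k < size s) P (tnth t k) (tnth (in_tuple s) k).

Section Fox.
Variable I : choiceType.
Local Notation F := (free_group I).
Implicit Types (g h : F) (i j : I).

Definition fox_letter i (a : I * bool) : grpring F :=
  if a.1 == i then if a.2 then 1 else - gr_of (fg_of [:: a]) else 0.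

Fixpoint fox_word i (s : seq (I * bool)) : grpring F :=
  if s is a :: s' then fox_letter i a + gr_of (fg_of [:: a]) * fox_word i s'
  else 0.

Definition fox i g : grpring F := fox_word i (fg_word g).

Lemma fg_of_cat s t : fg_of (s ++ t) = (fg_of s * fg_of t)%g :> F.
Proof.
by apply: val_inj; rewrite /= fg_reduce_catl fg_reduce_catr.
Qed.

Lemma fox_word_cat i s t :
  fox_word i (s ++ t) = fox_word i s + gr_of (fg_of s) * fox_word i t.
Proof.
elim: s => /= [|a s ->]; first by rewrite add0r [_ * _]mul1r.
by rewrite (fg_of_cat [:: a] s) gr_ofM mulrDr mulrA addrA.
Qed.

Lemma fox_letterV i a :
  fox_letter i a + gr_of (fg_of [:: a]) * fox_letter i (linv a) = 0.
Proof.
have aV : (fg_of [:: a] * fg_of [:: linv a])%g = 1%g :> F.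
  by rewrite -fg_of_cat; apply: val_inj; rewrite /= eqxx.
have Va : (fg_of [:: linv a] * fg_of [:: a])%g = 1%g :> F.
  by rewrite -fg_of_cat; apply: val_inj; rewrite /= linvK eqxx.
rewrite /fox_letter /=; case: (a.1 == i); last by rewrite mulr0 addr0.
case: a.2 => /=; last by rewrite mulr1 addNr.
by rewrite mulrN -gr_ofM aV subrr.
Qed.

Lemma fox_reduce i s : fox_word i (fg_reduce s) = fox_word i s.
Proof.
elim: s => //= a s IHs; rewrite -{}IHs.
have: fg_reduced (fg_reduce s) by apply: fg_reduce_reduced.
case: (fg_reduce s) => //= b t _; case: eqVneq => //= ->.
rewrite mulrDr addrA fox_letterV add0r mulrA -gr_ofM -fg_of_cat /=.
suff ->: fg_of [:: a; linv a] = 1%g :> F by rewrite [_ * _]mul1r.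
by apply: val_inj; rewrite /= eqxx.
Qed.

Lemma fox_gen i j : fox i (fg_gen j) = (j == i)%:R.
Proof. by rewrite /fox /= mulr0 addr0 /fox_letter /=; case: (j == i). Qed.

Lemma foxM i g h : fox i (g * h)%g = fox i g + gr_of g * fox i h.
Proof.
rewrite /fox fox_reduce fox_word_cat; congr (_ + gr_of _ * _).
by apply: val_inj; apply: fg_wordK.
Qed.

End Fox.

Section Presentation.
Variables (n m : nat) (r : 'I_m -> 'FG_n).

Inductive normal_closure : 'FG_n -> Prop :=
| NCrel k : normal_closure (r k)
| NC1 : normal_closure 1%g
| NCM g h : normal_closure g -> normal_closure h -> normal_closure (g * h)%g
| NCV g : normal_closure g -> normal_closure (g^-1)%g
| NCJ g h : normal_closure g -> normal_closure (g ^ h)%g.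

(* The map phi identifies G with < x_1, .., x_n | r_1, .., r_m >. *)
Definition presents (G : groupType) (phi : {multiplicative 'FG_n -> G}) :=
  (forall y, exists g, phi g = y) /\
  (forall g, phi g = 1%g <-> normal_closure g).

End Presentation.

(* H_1(G; Q) is computed with the rational bar complex: every 1-chain is a
   cycle and d [g|h] = [h] - [gh] + [g]. *)
Definition bar_boundary2 (G : groupType) :
    {freeg (G * G) / rat} -> {freeg G / rat} :=
  fglift (fun p : G * G => << p.2 >> - << (p.1 * p.2)%g >> + << p.1 >>).

Definition is_betti1 (G : groupType) (b : nat) :=
  exists y : 'I_b -> {freeg G / rat}, forall z : {freeg G / rat},
    exists! a : 'rV[rat]_b, exists c,
      z = \sum_(i < b) a 0 i *: y i + bar_boundary2 c.

(* Chains are row vectors and a boundary map d acts by c |-> c *m d.  The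
   quotient cycles / boundaries is carried by the complement of the boundaries
   in the cycles; hcls is the quotient map. *)
Section Homology.
Variables (K : fieldType) (p q s : nat) (D' : 'M[K]_(p, q)) (D : 'M[K]_(q, s)).

Definition cycles : {vspace 'rV[K]_q} := lker (linfun (mulmxr D)).
Definition boundaries : {vspace 'rV[K]_q} := limg (linfun (mulmxr D')).
Definition homology := subvs_of (cycles :\: boundaries)%VS.

HB.instance Definition _ := Vector.on homology.

Definition hcls : 'Hom('rV[K]_q, homology) :=
  (linfun (vsproj (cycles :\: boundaries)) \o addv_pi1 cycles boundaries)%VF.

Lemma mem_cycles c : (c \in cycles) = (c *m D == 0).
Proof. by rewrite memv_ker lfunE. Qed.

Lemma mem_boundariesP c : reflect (exists e, c = e *m D') (c \in boundaries).
Proof.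
apply: (iffP memv_imgP) => [[e _ ->]|[e ->]]; exists e; rewrite ?memvf ?lfunE //.
Qed.

Lemma val_hcls c : vsval (hcls c) = addv_pi1 cycles boundaries c.
Proof. by rewrite comp_lfunE lfunE; apply: vsprojK; apply: memv_pi. Qed.

Lemma hcls_cycle (x : homology) : vsval x \in cycles.
Proof. by apply: subvP (subvsP x); apply: diffvSl. Qed.

Lemma val_hclsP c : c \in cycles -> c - vsval (hcls c) \in boundaries.
Proof.
move=> cyc_c; rewrite val_hcls.
have cycD : c \in (cycles + boundaries)%VS by apply: subvP cyc_c; apply: addvSl.
by rewrite -{1}(addv_pi1_pi2 cycD) addrC addKr memv_pi2.
Qed.

Lemma hcls_eq0 c : c \in cycles -> (hcls c == 0) = (c \in boundaries).
Proof.
move=> cyc_c; have bd_c := val_hclsP cyc_c.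
have v0 : vsval (0 : homology) = 0 by apply: linear0.
apply/eqP/idP => [c0|bd]; first by rewrite c0 v0 subr0 in bd_c.
apply: val_inj; apply: etrans (esym v0); apply/eqP.
rewrite -[val]/(@vsval _ _ _) -memv0 -(capv_diff cycles boundaries).
rewrite memv_cap subvsP /=.
by have := memvB bd bd_c; rewrite subKr.
Qed.

Lemma hcls_val (x : homology) : hcls (vsval x) = x.
Proof.
apply: val_inj; apply: etrans (val_hcls _) _.
by apply: daddv_pi_id; [apply: capv_diff | apply: subvsP].
Qed.

End Homology.

Section Cohomology.
Variables (K : fieldType) (p q s : nat) (D' : 'M[K]_(p, q)) (D : 'M[K]_(q, s)).

(* The cochain a takes the value a *m c^T on the chain c. *)
Definition cohomology := homology D^T D'^T.

HB.instance Definition _ := Vector.on cohomology.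

Definition kronecker (a : cohomology) (c : homology D' D) : K :=
  (vsval a *m (vsval c)^T) 0 0.

Lemma kronecker_cls a c :
    a \in cycles D'^T -> c \in cycles D ->
  kronecker (hcls D^T D'^T a) (hcls D' D c) = (a *m c^T) 0 0.
Proof.
move=> cyc_a cyc_c; rewrite /kronecker.
have /mem_boundariesP[e def_e] := val_hclsP D^T cyc_a.
have /mem_boundariesP[f def_f] := val_hclsP D' cyc_c.
have := hcls_cycle (hcls D' D c); rewrite mem_cycles => /eqP cyc_hc.
move: cyc_a; rewrite mem_cycles => /eqP cyc_a.
rewrite -[in RHS](subrK (vsval (hcls D' D c)) c) def_f.
rewrite linearD /= trmx_mul mulmxDr mulmxA cyc_a mul0mx add0r.
rewrite -[in RHS](subrK (vsval (hcls D^T D'^T a)) a) def_e mulmxDl.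
by rewrite -mulmxA -trmx_mul cyc_hc trmx0 mulmx0 add0r.
Qed.

End Cohomology.

Section PresentationComplex.
Variables (n m : nat) (r : 'I_m -> 'FG_n).

Definition fox_d1 : 'M[grpring 'FG_n]_(n, 1) :=
  \matrix_(i, _) (gr_of (fg_gen i) - 1).
Definition fox_d2 : 'M[grpring 'FG_n]_(m, n) := \matrix_(k, i) fox i (r k).

(* The cellular complex C_*(K; Q) = Q \otimes_ZG C_*(K~); deg is the
   augmentation, and it does not change under ZF -> ZG. *)
Definition cell_d1 : 'M[rat]_(n, 1) := map_mx (fun x => (deg x)%:~R) fox_d1.
Definition cell_d2 : 'M[rat]_(m, n) := map_mx (fun x => (deg x)%:~R) fox_d2.
Definition cell_d3 : 'M[rat]_(0, m) := 0.

(* Lower indices are for homology, upper ones (H1, H2) for cohomology. *)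
Definition H_1 := homology cell_d2 cell_d1.
Definition H_2 := homology cell_d3 cell_d2.
Definition H1 := cohomology cell_d2 cell_d1.
Definition H2 := cohomology cell_d3 cell_d2.

HB.instance Definition _ := Vector.on H_1.
HB.instance Definition _ := Vector.on H_2.
HB.instance Definition _ := Vector.on H1.
HB.instance Definition _ := Vector.on H2.

Definition H_1_class (c : 'rV[rat]_n) : H_1 := hcls cell_d2 cell_d1 c.
Definition H_2_class (c : 'rV[rat]_m) : H_2 := hcls cell_d3 cell_d2 c.
Definition H1_class (a : 'rV[rat]_n) : H1 := hcls cell_d1^T cell_d2^T a.
Definition H2_class (a : 'rV[rat]_m) : H2 := hcls cell_d2^T cell_d3^T a.

Definition edge (i : 'I_n) : 'rV[rat]_n := delta_mx 0 i.
Definition face (k : 'I_m) : 'rV[rat]_m := delta_mx 0 k.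

Definition kronecker1 : H1 -> H_1 -> rat := @kronecker _ _ _ _ cell_d2 cell_d1.
Definition kronecker2 : H2 -> H_2 -> rat := @kronecker _ _ _ _ cell_d3 cell_d2.

End PresentationComplex.

Section CupProduct.
Variables (n m : nat) (G : groupType).
Variables (phi : {multiplicative 'FG_n -> G}) (r : 'I_m -> 'FG_n).
Local Notation ZG := (grpring G).

Definition grpring_map : grpring 'FG_n -> ZG := fglift (fun g => gr_of (phi g)).

(* The cellular complex of the universal cover of K: the chains are row vectors
   over ZG, and the boundary of the 2-cell of r_k is row k of cover_d2. *)
Definition cover_d1 : 'M[ZG]_(n, 1) := map_mx grpring_map (fox_d1 n).
Definition cover_d2 : 'M[ZG]_(m, n) := map_mx grpring_map (fox_d2 r).

(* The bar resolution in degrees 0, 1, 2; in degree 0 the basis is [ ] = 1. *)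
Definition bar_d1 : {freeg G / ZG} -> ZG^o :=
  fglift (fun g : G => gr_of g - 1 : ZG^o).
Definition bar_d2 : {freeg (G * G) / ZG} -> {freeg G / ZG} :=
  fglift (fun p : G * G =>
    gr_of p.1 *: << p.2 >> - << (p.1 * p.2)%g >> + << p.1 >>).

(* ZG-chain maps from the cellular complex to the bar resolution that extend
   the identity of Z; they induce in cohomology the map of the classifying map
   K -> K(G, 1). *)
Record bar_chain_map := BarChainMap {
  bcm0 : {linear 'rV[ZG]_1 -> ZG^o};
  bcm1 : {linear 'rV[ZG]_n -> {freeg G / ZG}};
  bcm2 : {linear 'rV[ZG]_m -> {freeg (G * G) / ZG}};
  bcm_aug : forall c, deg (bcm0 c : ZG) = deg (c 0 0 : ZG);
  bcm_d1 : forall c, bar_d1 (bcm1 c) = bcm0 (c *m cover_d1);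
  bcm_d2 : forall c, bar_d2 (bcm2 c) = bcm1 (c *m cover_d2)
}.

(* The value on b of the ZG-linear cochain, with values in the trivial module
   Q, whose values on the basis elements are given by v. *)
Definition cochain_eval (T : choiceType) (v : T -> rat) (b : {freeg T / ZG}) :
    rat :=
  \sum_(t <- dom b) (deg (coeff t b : ZG))%:~R * v t.

Definition pullback1 (T : bar_chain_map) (v : G -> rat) : 'rV[rat]_n :=
  \row_i cochain_eval v (bcm1 T (delta_mx 0 i)).
Definition pullback2 (T : bar_chain_map) (v : G * G -> rat) : 'rV[rat]_m :=
  \row_k cochain_eval v (bcm2 T (delta_mx 0 k)).

Definition is_bar_cocycle1 (v : G -> rat) :=
  forall g h : G, v (g * h)%g = v g + v h.

(* H^1(G; Q) -> H^1(K; Q) is an isomorphism, and cup products are natural: the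
   cup product of u1 and u2 is the image of the product in H^2(G; Q) of the
   bar cocycles that represent them. *)
Definition is_cup (u1 u2 : H1 r) (c : H2 r) :=
  exists (T : bar_chain_map) (v1 v2 : G -> rat),
    [/\ is_bar_cocycle1 v1 /\ is_bar_cocycle1 v2,
        H1_class r (pullback1 T v1) = u1,
        H1_class r (pullback1 T v2) = u2
      & H2_class r (pullback2 T (fun p => v1 p.1 * v2 p.2)) = c].

(* When phi presents G, is_cup u1 u2 holds of exactly one class: T exists and
   is unique up to chain homotopy. *)
Definition cup (u1 u2 : H1 r) : H2 r := xget 0 [set c | is_cup u1 u2 c].

End CupProduct.

Section Echelon.
Variables (R : pzRingType) (m n : nat) (A : 'M[R]_(m, n)).

(* The first non-zero entry of row k is in column i. *)
Definition is_pivot (k : 'I_m) (i : 'I_n) : Prop :=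
  A k i <> 0 /\ forall j : 'I_n, (j < i)%N -> A k j = 0.

Definition row_echelon := forall (k k' : 'I_m) (i' : 'I_n),
  (k < k')%N -> is_pivot k' i' -> exists2 i : 'I_n, is_pivot k i & (i < i')%N.

Definition is_pivot_column (i : 'I_n) := exists k, is_pivot k i.

End Echelon.

Definition expgz (G : groupType) (x : G) (z : int) : G :=
  match z with Posz k => (x ^+ k)%g | Negz k => (x ^- k.+1)%g end.

Definition exponent_matrix n m (w : 'I_m -> 'FG_n) : 'M[rat]_(m, n) :=
  \matrix_(k, i) exponent_sum i (w k).

Definition echelon_approximation n m (r : 'I_m -> 'FG_n) (C : 'M[int]_m)
    (w : 'I_m -> 'FG_n) :=
  [/\ C \in unitmx,
      forall k, w k = (\prod_(l < m) expgz (r l) (C l k))%g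
    & row_echelon (exponent_matrix w)].

(* c enumerates increasingly the columns that contain no pivot. *)
Definition enumerates_nonpivots n m b (A : 'M[rat]_(m, n)) (c : 'I_b -> 'I_n) :=
  (forall i j : 'I_b, (i < j)%N -> (c i < c j)%N) /\
  (forall i, (exists j, c j = i) <-> ~ is_pivot_column A i).

Section MagnusGroup.
Variables (n m b : nat) (w : 'I_m -> 'FG_n) (c : 'I_b -> 'I_n).

(* H_1(G_e; Q) is the first homology of the presentation complex of w. *)
Definition H_1_basis : b.-tuple (H_1 w) :=
  [tuple H_1_class w (edge (c j)) | j < b].

(* The matrix of pi : F_Q -> H_1(G_e; Q) in the bases x and y. *)
Definition proj_coord : 'M[rat]_(n, b) :=
  \matrix_(i, j) coord H_1_basis j (H_1_class w (edge i)).

Definition kappa (g : 'FG_n) : ncseries 'I_b :=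
  tensor_map proj_coord (magnus g).

End MagnusGroup.

(* Main.v *)
Require Import Defs.
From HB Require Import structures.
From mathcomp Require Import all_boot all_order all_algebra ring.
From mathcomp Require Import boolp.
From mathcomp.multinomials Require Import freeg.

Set Implicit Arguments.
Unset Strict Implicit.
Unset Printing Implicit Defensive.

Import GRing.Theory Num.Theory.
Local Open Scope ring_scope.

(* Let v1, v2 be bar cocycles of degree 1 on G.  The cocycle v1 \cup v2 on the
   bar resolution has the non-equivariant primitive Psi (a [g]) = v1(a) v2(g),
   for which Psi (a x) = V1(a) v2(x) + eps(a) Psi(x), where V1 is the linear
   extension of v1 to ZG.  For any chain map T from the cellular complex to the
   bar resolution, the pullback of v1 \cup v2 takes therefore on the 2-cell of
   r_k the value \sum_i V1(phi (d_i r_k)) v2(phi x_i), up to a coboundary.  By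
   induction on the word g, V1(phi (d_i g)) = \sum_j v1(phi x_j) M(g)_{j,i}, so
   that this value is \sum_{j,i} M(r_k)_{j,i} v1(phi x_j) v2(phi x_i); this
   form is additive on the kernel of phi, hence its value on gamma_l is obtained
   by replacing r_k with w_l.  When v1 and v2 represent u_i and u_j, their
   values on the generators are the coefficients of the projection F_Q -> H_1,
   and the form is kappa(w_l)_{i,j}.  Finally, the echelon form of the exponent
   matrix shows that classes in H^2(K; Q) are detected by the gamma_l with
   l > n - b. *)

(** * Additive maps on free modules and group rings *)

Section FreegSum.
Variables (R : nzRingType) (K : choiceType) (V : zmodType).
Variable F : K -> {additive R -> V}.
Implicit Types x y : {freeg K / R}.

(** Coefficients enter through arbitrary additive maps rather than by scaling, so that maps which
    are not linear over [R] can also be built. *)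
Definition freeg_sum x : V := \sum_(t <- dom x) F t (coeff t x).

Lemma freeg_sum_superset (s : seq K) x :
  uniq s -> {subset dom x <= s} -> freeg_sum x = \sum_(t <- s) F t (coeff t x).
Proof.
move=> uniq_s sub; rewrite /freeg_sum [RHS](bigID (mem (dom x))) /=.
rewrite [X in _ = _ + X]big1 ?addr0 => [|t]; last first.
  by move/coeff_outdom->; rewrite raddf0.
rewrite -[RHS]big_filter; apply: perm_big; apply: uniq_perm.
- exact: uniq_dom.
- exact: filter_uniq.
by move=> t; rewrite mem_filter; case: (boolP (t \in dom x)) => // /sub->.
Qed.

Lemma freeg_sum_is_zmod_morphism : zmod_morphism freeg_sum.
Proof.
move=> x y; pose s := undup (dom x ++ dom y).
have us : uniq s by apply: undup_uniq.
rewrite !(@freeg_sum_superset s) //; last 3 first.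
- by move=> t ty; rewrite mem_undup mem_cat ty orbT.
- by move=> t tx; rewrite mem_undup mem_cat tx.
- by move=> t; rewrite mem_undup; apply: domB.
by rewrite -sumrB; apply: eq_bigr => t _; rewrite coeffB raddfB.
Qed.

HB.instance Definition _ := GRing.isZmodMorphism.Build {freeg K / R} V
  freeg_sum freeg_sum_is_zmod_morphism.

Lemma freeg_sumU k t : freeg_sum << k *g t >> = F t k.
Proof.
have sub: {subset dom << k *g t >> <= [:: t]}.
  move=> t'; rewrite mem_dom coeffU inE (eq_sym t'); case: (t == t') => //.
  by rewrite mulr0 eqxx.
by rewrite (freeg_sum_superset _ sub) // big_seq1 coeffU eqxx mulr1.
Qed.

End FreegSum.

Lemma freeg_scaleZU (R : nzRingType) (K : choiceType) (a k : R) (t : K) :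
  a *: << k *g t >> = << (a * k) *g t >>.
Proof. by apply/eqP/freeg_eqP => t'; rewrite coeffZ !coeffU mulrA. Qed.

Lemma freeg_ind (R : nzRingType) (K : choiceType) (P : {freeg K / R} -> Prop) :
  P 0 -> (forall x y, P x -> P y -> P (x + y)) ->
  (forall k t, P << k *g t >>) -> forall x, P x.
Proof.
move=> P0 PD PU x; rewrite -[x]freeg_sumE.
by elim/big_ind: _ => // t _; apply: PU.
Qed.

Section IntLift.
Variables (K : choiceType) (v : K -> rat).

Definition int_scale t (k : int) : rat := k%:~R * v t.

Lemma int_scale_is_zmod_morphism t : zmod_morphism (int_scale t).
Proof. by move=> k l; rewrite /int_scale rmorphB mulrBl. Qed.

HB.instance Definition _ t := GRing.isZmodMorphism.Build int rat
  (int_scale t) (int_scale_is_zmod_morphism t).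

Definition int_lift : {freeg K / int} -> rat := freeg_sum int_scale.
HB.instance Definition _ := GRing.Additive.on int_lift.

Lemma int_liftU k t : int_lift << k *g t >> = k%:~R * v t.
Proof. exact: freeg_sumU. Qed.

End IntLift.

Section GroupRingLift.
Variable G : groupType.
Local Notation ZG := (grpring G).
Implicit Types (x y : ZG) (g h : G).

HB.instance Definition _ (v : G -> rat) :=
  GRing.isZmodMorphism.Build ZG rat (int_lift v) (raddfB (int_lift v)).

HB.instance Definition _ := GRing.isZmodMorphism.Build ZG int
  (@deg G) (raddfB (@deg G)).

Lemma gr_ind (P : ZG -> Prop) :
  P 0 -> (forall x y, P x -> P y -> P (x + y)) -> (forall x, P x -> P (- x)) ->
  (forall g, P (gr_of g)) -> forall x, P x.
Proof.
move=> P0 PD PN Pg; apply: freeg_ind => // k g.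
have Pn (n : nat) : P << n%:Z *g g >>.
  elim: n => [|n IHn]; first by rewrite freegU0.
  by rewrite -addn1 PoszD -freegUD; apply: PD => //; apply: Pg.
case: k => n; first exact: Pn.
by rewrite NegzE -freegUN; apply: PN; apply: Pn.
Qed.

Lemma deg_gr_of g : deg (gr_of g : ZG) = 1.
Proof. exact: degU. Qed.

Lemma int_lift_gr_of v g : int_lift v (gr_of g : ZG) = v g.
Proof. by rewrite int_liftU mul1r. Qed.

Lemma degM x y : deg (x * y : ZG) = deg x * deg y.
Proof.
elim/gr_ind: x => [|x1 x2 IH1 IH2|x IH|g].
- by rewrite mul0r raddf0 mul0r.
- by rewrite mulrDl !raddfD /= IH1 IH2 mulrDl.
- by rewrite mulNr !raddfN /= IH mulNr.
elim/gr_ind: y => [|x1 x2 IH1 IH2|x IH|h].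
- by rewrite mulr0 raddf0 mulr0.
- by rewrite mulrDr !raddfD /= IH1 IH2 mulrDr.
- by rewrite mulrN !raddfN /= IH mulrN.
by rewrite -gr_ofM !deg_gr_of.
Qed.

(** Both sides are additive in [x] and in [y]; on group elements this is the cocycle identity of
    [v]. *)
Lemma int_liftM (v : G -> rat) x y : is_bar_cocycle1 v ->
  int_lift v (x * y : ZG) =
  int_lift v x * (deg y)%:~R + (deg x)%:~R * int_lift v y.
Proof.
move=> vM; elim/gr_ind: x => [|x1 x2 IH1 IH2|x IH|g].
- by rewrite mul0r !raddf0 !mul0r addr0.
- by rewrite mulrDl !raddfD /= IH1 IH2 mulrDl ?rmorphD /= mulrDl addrACA.
- by rewrite mulNr !raddfN /= IH ?rmorphN /= !mulNr opprD.
elim/gr_ind: y => [|x1 x2 IH1 IH2|x IH|h].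
- by rewrite mulr0 !raddf0 !mulr0 addr0.
- by rewrite mulrDr !raddfD /= IH1 IH2 ?rmorphD /= !mulrDr addrACA.
- by rewrite mulrN !raddfN /= IH ?rmorphN /= !mulrN opprD.
by rewrite -gr_ofM !deg_gr_of !int_lift_gr_of vM mulr1 mul1r.
Qed.

Lemma bar_cocycle1_1 (v : G -> rat) : is_bar_cocycle1 v -> v 1%g = 0.
Proof. by move=> vM; apply: (addrI (v 1%g)); rewrite -vM mulg1 addr0. Qed.

Lemma deg_gr_of_sub1 g : deg (gr_of g - 1 : ZG) = 0.
Proof. by rewrite -gr_of1 raddfB /= !deg_gr_of. Qed.

Lemma int_lift_gr_of_sub1 (v : G -> rat) g :
  is_bar_cocycle1 v -> int_lift v (gr_of g - 1 : ZG) = v g.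
Proof.
by move=> vM; rewrite -gr_of1 raddfB /= !int_lift_gr_of bar_cocycle1_1 ?subr0.
Qed.

End GroupRingLift.

Lemma multiplicative1 (G H : groupType) (f : {multiplicative G -> H}) :
  f 1%g = 1%g.
Proof. by apply: (@mulgI _ (f 1%g)); rewrite -gmulfM !mulg1. Qed.

Lemma multiplicativeV (G H : groupType) (f : {multiplicative G -> H}) g :
  f g^-1%g = (f g)^-1%g.
Proof.
by apply: (@mulgI _ (f g)); rewrite -gmulfM !mulgV multiplicative1.
Qed.

Section GroupRingMap.
Variables (n : nat) (G : groupType) (phi : {multiplicative 'FG_n -> G}).

HB.instance Definition _ := GRing.isZmodMorphism.Build
  (grpring 'FG_n) (grpring G) (grpring_map phi) (@lift_is_additive _ _ _ _).

Lemma grpring_mapU g : grpring_map phi (gr_of g) = gr_of (phi g).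
Proof. by rewrite /grpring_map liftU scale1r. Qed.

Lemma grpring_mapM x y :
  grpring_map phi (x * y) = grpring_map phi x * grpring_map phi y.
Proof.
elim/gr_ind: x => [|x1 x2 IH1 IH2|x IH|g].
- by rewrite mul0r !raddf0 mul0r.
- by rewrite mulrDl !raddfD /= IH1 IH2 mulrDl.
- by rewrite mulNr !raddfN /= IH mulNr.
elim/gr_ind: y => [|x1 x2 IH1 IH2|x IH|h].
- by rewrite mulr0 raddf0 mulr0.
- by rewrite mulrDr !raddfD /= IH1 IH2 mulrDr.
- by rewrite mulrN !raddfN /= IH mulrN.
by rewrite -gr_ofM !grpring_mapU gmulfM -gr_ofM.
Qed.

Lemma grpring_map1 : grpring_map phi 1 = 1.
Proof. by rewrite -gr_of1 grpring_mapU multiplicative1. Qed.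

Lemma deg_grpring_map x : deg (grpring_map phi x) = deg x.
Proof.
elim/gr_ind: x => [|x1 x2 IH1 IH2|x IH|g].
- by rewrite !raddf0.
- by rewrite !raddfD /= IH1 IH2.
- by rewrite !raddfN /= IH.
by rewrite grpring_mapU !deg_gr_of.
Qed.

Lemma int_lift_grpring_map v x :
  int_lift v (grpring_map phi x) = int_lift (v \o phi) x.
Proof.
elim/gr_ind: x => [|x1 x2 IH1 IH2|x IH|g].
- by rewrite !raddf0.
- by rewrite !raddfD /= IH1 IH2.
- by rewrite !raddfN /= IH.
by rewrite grpring_mapU !int_lift_gr_of.
Qed.

End GroupRingMap.

(** * Pulling back cup products from the bar resolution *)

Section BarCochains.
Variable G : groupType.
Local Notation ZG := (grpring G).

Section Eval.
Variables (T : choiceType) (v : T -> rat).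

Definition deg_scale (t : T) (a : ZG) : rat := (deg a)%:~R * v t.

Lemma deg_scale_is_zmod_morphism t : zmod_morphism (deg_scale t).
Proof. by move=> a b; rewrite /deg_scale raddfB rmorphB mulrBl. Qed.

HB.instance Definition _ t := GRing.isZmodMorphism.Build ZG rat
  (deg_scale t) (deg_scale_is_zmod_morphism t).

HB.instance Definition _ := GRing.isZmodMorphism.Build {freeg T / ZG} rat
  (@cochain_eval G T v) (freeg_sum_is_zmod_morphism deg_scale).

Lemma cochain_evalU (a : ZG) t :
  cochain_eval v << a *g t >> = (deg a)%:~R * v t.
Proof. exact: (freeg_sumU deg_scale). Qed.

Lemma cochain_evalZ (a : ZG) x :
  cochain_eval v (a *: x) = (deg a)%:~R * cochain_eval v x.
Proof.
elim/freeg_ind: x => [|x y IHx IHy|b t].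
- by rewrite scaler0 raddf0 mulr0.
- by rewrite scalerDr !raddfD /= IHx IHy mulrDr.
by rewrite freeg_scaleZU !cochain_evalU degM intrM mulrA.
Qed.

End Eval.

HB.instance Definition _ := GRing.Linear.copy (@bar_d1 G)
  (fglift (fun g : G => gr_of g - 1 : ZG^o)).
HB.instance Definition _ := GRing.Linear.copy (@bar_d2 G)
  (fglift (fun p : G * G =>
    gr_of p.1 *: << p.2 >> - << (p.1 * p.2)%g >> + << p.1 >>
      : {freeg G / ZG})).

Section CupPrimitive.
Variables v1 v2 : G -> rat.

Definition lift_scale (g : G) (a : ZG) : rat := int_lift v1 a * v2 g.

Lemma lift_scale_is_zmod_morphism t : zmod_morphism (lift_scale t).
Proof. by move=> a b; rewrite /lift_scale raddfB mulrBl. Qed.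

HB.instance Definition _ t := GRing.isZmodMorphism.Build ZG rat
  (lift_scale t) (lift_scale_is_zmod_morphism t).

Definition cup_primitive : {freeg G / ZG} -> rat := freeg_sum lift_scale.
HB.instance Definition _ := GRing.Additive.on cup_primitive.

Lemma cup_primitiveU a g : cup_primitive << a *g g >> = int_lift v1 a * v2 g.
Proof. exact: freeg_sumU. Qed.

Hypothesis v1M : is_bar_cocycle1 v1.

Lemma cup_primitiveZ a x : cup_primitive (a *: x) =
  int_lift v1 a * cochain_eval v2 x + (deg a)%:~R * cup_primitive x.
Proof.
elim/freeg_ind: x => [|x y IHx IHy|b t].
- by rewrite scaler0 !raddf0 !mulr0 addr0.
- by rewrite scalerDr !raddfD /= IHx IHy !mulrDr addrACA.
rewrite freeg_scaleZU !cup_primitiveU cochain_evalU int_liftM //.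
by rewrite mulrDl !mulrA.
Qed.

Hypothesis v2M : is_bar_cocycle1 v2.

(** On a[g|h], [cup_primitiveZ] leaves v2(d[g|h]), which is zero because [v2] is a cocycle, and
    Psi(d[g|h]) = v1(g) v2(h), because Psi vanishes on [g] and [gh], whose coefficient is 1. *)
Lemma cup_primitive_bar_d2 x :
  cup_primitive (bar_d2 x) = cochain_eval (fun p => v1 p.1 * v2 p.2) x.
Proof.
elim/freeg_ind: x => [|x y IHx IHy|a [g h]].
- by rewrite !raddf0.
- by rewrite !raddfD /= IHx IHy.
rewrite cochain_evalU /bar_d2 liftU cup_primitiveZ /=.
have ->: cochain_eval v2
    (gr_of g *: << h >> - << (g * h)%g >> + << g >> : {freeg G / ZG}) = 0.
  rewrite raddfD raddfB /= cochain_evalZ !cochain_evalU deg_gr_of.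
  by rewrite -(gr_of1 G) !deg_gr_of v2M; ring.
rewrite mulr0 add0r raddfD raddfB /= cup_primitiveZ cochain_evalU.
rewrite !cup_primitiveU -(gr_of1 G) !int_lift_gr_of deg_gr_of.
by rewrite bar_cocycle1_1 // !mul0r mulr0 oppr0 !addr0 mul1r.
Qed.

End CupPrimitive.

Lemma int_lift_bar_d1 (v : G -> rat) x : is_bar_cocycle1 v ->
  int_lift v (bar_d1 x : ZG) = cochain_eval v x.
Proof.
move=> vM; elim/freeg_ind: x => [|x y IHx IHy|a g].
- by rewrite !raddf0.
- by rewrite !raddfD /= IHx IHy.
rewrite cochain_evalU /bar_d1 liftU (int_liftM _ _ vM) deg_gr_of_sub1.
by rewrite int_lift_gr_of_sub1 // mulr0 add0r.
Qed.

End BarCochains.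

Section Pullback.
Variables (n m : nat) (G : groupType).
Variables (phi : {multiplicative 'FG_n -> G}) (r : 'I_m -> 'FG_n).
Variable T : bar_chain_map phi r.
Local Notation ZG := (grpring G).

(** The value is V(d T(e_i)) = V((x_i - 1) T(1)). Since x_i - 1 has augmentation 0 and T(1) has
    augmentation 1, only v(phi x_i) remains, whatever [T] is. *)
Lemma pullback1E v i :
  is_bar_cocycle1 v -> pullback1 T v 0 i = v (phi (fg_gen i)).
Proof.
move=> vM; rewrite mxE -int_lift_bar_d1 // bcm_d1 -rowE.
have ->: row i (cover_d1 phi) = (gr_of (phi (fg_gen i)) - 1) *: delta_mx 0 0.
  apply/rowP => j; rewrite !mxE !ord1 eqxx mulr1 raddfB /=.
  by rewrite grpring_mapU grpring_map1.
rewrite linearZ /= (int_liftM _ _ vM) bcm_aug deg_gr_of_sub1.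
by rewrite int_lift_gr_of_sub1 // mul0r addr0 mxE !eqxx -gr_of1 deg_gr_of mulr1.
Qed.

(** Psi is applied to d T = T d on the 2-cell of r_k. By [cup_primitiveZ] each term phi(d_i r_k)
    T(e_i) splits in two; the part with the augmentation is the coboundary of e_i -> Psi(T e_i). *)
Lemma pullback2E v1 v2 : is_bar_cocycle1 v1 -> is_bar_cocycle1 v2 ->
  pullback2 T (fun p => v1 p.1 * v2 p.2) =
  (\row_k \sum_i int_lift (v1 \o phi) (fox i (r k)) * v2 (phi (fg_gen i)))
  + (\row_i cup_primitive v1 v2 (bcm1 T (delta_mx 0 i))) *m (cell_d2 r)^T.
Proof.
move=> v1M v2M; apply/rowP => k; rewrite !mxE -cup_primitive_bar_d2 //.
rewrite bcm_d2 -rowE [row _ _]row_sum_delta !raddf_sum /= -big_split /=.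
apply: eq_bigr => i _; rewrite linearZ /= cup_primitiveZ // !mxE.
rewrite deg_grpring_map int_lift_grpring_map -(pullback1E _ v2M) mxE.
by rewrite [X in _ + X]mulrC.
Qed.

End Pullback.

(** * Fox derivatives and the Magnus expansion *)

(** Additivity is asked only on a subgroup [P]: the Magnus form below is additive on the common
    kernel of two homomorphisms, but in general not on the whole free group. *)
Lemma local_morph_prod_expgz (G : groupType) (P : G -> Prop) (f : G -> rat) :
    P 1%g -> (forall g h, P g -> P h -> P (g * h)%g) ->
    (forall g, P g -> P g^-1%g) ->
    (forall g h, P g -> P h -> f (g * h)%g = f g + f h) ->
  forall m (s : 'I_m -> G) (z : 'I_m -> int), (forall l, P (s l)) ->
  f (\prod_(l < m) expgz (s l) (z l))%g = \sum_(l < m) (z l)%:~R * f (s l).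
Proof.
move=> P1 PM PV fM m s z Ps.
have f1 : f 1%g = 0 by apply: (addrI (f 1%g)); rewrite -fM // mulg1 addr0.
have fV g : P g -> f g^-1%g = - f g.
  move=> Pg; apply: (addrI (f g)); rewrite -fM // ?subrr ?mulgV //.
  exact: PV.
have PX g k : P g -> P (g ^+ k)%g.
  by move=> Pg; elim: k => [|k IHk]; rewrite ?expg0 // expgS; apply: PM.
have fX g k : P g -> f (g ^+ k)%g = k%:R * f g.
  move=> Pg; elim: k => [|k IHk]; first by rewrite expg0 mul0r.
  by rewrite expgS fM ?IHk -?natr1 ?mulrDl ?mul1r 1?addrC //; apply: PX.
have Pexp l : P (expgz (s l) (z l)).
  by rewrite /expgz; case: (z l) => k; [|apply: PV]; apply: PX.
suff H (t : seq 'I_m) : P (\prod_(l <- t) expgz (s l) (z l))%g /\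
    f (\prod_(l <- t) expgz (s l) (z l))%g = \sum_(l <- t) (z l)%:~R * f (s l).
  by have [] := H (index_enum 'I_m).
elim: t => [|l t [Pt IHt]]; first by rewrite !big_nil.
rewrite !big_cons fM // IHt; split; first exact: PM.
congr (_ + _); rewrite /expgz; case: (z l) => k; first exact: fX.
by rewrite NegzE fV ?fX ?mulrNz ?mulNr //; apply: PX.
Qed.

Lemma fg_ind (I : choiceType) (P : free_group I -> Prop) :
  P 1%g -> (forall i, P (fg_gen i)) ->
  (forall g h, P g -> P h -> P (g * h)%g) -> (forall g, P g -> P g^-1%g) ->
  forall g, P g.
Proof.
move=> P1 Pgen PM PV g.
have ->: g = fg_of (fg_word g) by apply: val_inj; rewrite /= fg_wordK.
elim: (fg_word g) => [//|a w IHw].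
rewrite -cat1s fg_of_cat; apply: PM => //; case: a => i []; first exact: Pgen.
have ->: fg_of [:: (i, false)] = (fg_gen i)^-1%g by apply: val_inj.
exact: PV.
Qed.

(** Pattern of the comparisons below: two functions with the same defect of additivity differ by a
    homomorphism, which the generators determine. *)
Lemma fg_cocycle_eq0 (I : choiceType) (q : free_group I -> rat) :
  is_bar_cocycle1 q -> (forall i, q (fg_gen i) = 0) -> forall g, q g = 0.
Proof.
move=> qM q0; have q1 := bar_cocycle1_1 qM; elim/fg_ind => // [g h qg qh|g qg].
  by rewrite qM qg qh addr0.
by apply: (addrI (q g)); rewrite -qM mulgV q1 qg addr0.
Qed.

Section MagnusCoefficients.
Variable I : finType.
Implicit Types (i j : I) (g h : free_group I) (f : ncseries I).

Lemma magnus_nil g : magnus g [::] = 1.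
Proof.
have nilM f f' : (f * f') [::] = f [::] * f' [::] by apply: ncs_mul_nil.
elim/fg_ind: g => [|i|g h Mg Mh|g Mg].
- by rewrite magnus1.
- by rewrite magnus_gen ncs_addE addr0.
- by rewrite magnusM nilM Mg Mh mulr1.
by rewrite -[LHS]mul1r -{1}Mg -nilM -magnusM mulgV magnus1.
Qed.

Lemma exponent_sumM i g h :
  exponent_sum i (g * h)%g = exponent_sum i g + exponent_sum i h.
Proof.
rewrite /exponent_sum magnusM ncs_mulE /ncs_mul !big_ord_recl big_ord0 /=.
by rewrite !magnus_nil mul1r mulr1 addr0 addrC.
Qed.

Lemma exponent_sum_gen i j : exponent_sum i (fg_gen j) = (i == j)%:R.
Proof.
by rewrite /exponent_sum magnus_gen ncs_addE /ncs_var eqseq_cons andbT add0r.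
Qed.

Lemma magnusM2 i j g h : magnus (g * h)%g [:: i; j] =
  magnus g [:: i; j] + exponent_sum i g * exponent_sum j h + magnus h [:: i; j].
Proof.
rewrite /exponent_sum magnusM ncs_mulE /ncs_mul !big_ord_recl big_ord0 /=.
rewrite !magnus_nil mul1r mulr1 addr0 addrC; congr (_ + _).
by rewrite addrC.
Qed.

Lemma magnus2_gen i j k : magnus (fg_gen k) [:: i; j] = 0.
Proof. by rewrite magnus_gen ncs_addE /ncs_var eqseq_cons andbF addr0. Qed.

Lemma fg_cocycleE (q : free_group I -> rat) g : is_bar_cocycle1 q ->
  q g = \sum_i q (fg_gen i) * exponent_sum i g.
Proof.
move=> qM; apply/eqP; rewrite -subr_eq0; apply/eqP.
pose d h := q h - \sum_i q (fg_gen i) * exponent_sum i h.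
apply: (@fg_cocycle_eq0 _ d) => [h h'|j]; rewrite /d.
  rewrite qM addrACA -opprD -big_split /=; congr (_ - _).
  by apply: eq_bigr => i _; rewrite exponent_sumM mulrDr.
rewrite (bigD1 j) //= exponent_sum_gen eqxx mulr1 big1 ?addr0 ?subrr //.
by move=> i ne_ij; rewrite exponent_sum_gen (negPf ne_ij) mulr0.
Qed.

Lemma deg_fox i g : (deg (fox i g))%:~R = exponent_sum i g.
Proof.
apply/eqP; rewrite -subr_eq0; apply/eqP.
apply: (@fg_cocycle_eq0 _ (fun g => (deg (fox i g))%:~R - exponent_sum i g)).
  move=> h h'; rewrite foxM raddfD /= degM deg_gr_of mul1r rmorphD /=.
  by rewrite exponent_sumM opprD addrACA.
move=> j; rewrite fox_gen exponent_sum_gen eq_sym; case: eqP => _.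
  by rewrite -gr_of1 deg_gr_of subrr.
by rewrite raddf0 subrr.
Qed.

(** The Fox product rule gives the left side the defect q(g) epsilon_i(h), and [magnusM2] gives the
    right side the same one. On generators both sides vanish, since q(1) = 0. *)
Lemma int_lift_fox (q : free_group I -> rat) i g : is_bar_cocycle1 q ->
  int_lift q (fox i g) = \sum_j q (fg_gen j) * magnus g [:: j; i].
Proof.
move=> qM; apply/eqP; rewrite -subr_eq0; apply/eqP.
pose S h := \sum_j q (fg_gen j) * magnus h [:: j; i].
have SM h h' : S (h * h')%g = S h + q h * exponent_sum i h' + S h'.
  rewrite /S (fg_cocycleE h qM) mulr_suml -!big_split /=.
  by apply: eq_bigr => j _; rewrite magnusM2 !mulrDr mulrA.
apply: (@fg_cocycle_eq0 _ (fun h => int_lift q (fox i h) - S h)).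
  move=> h h'; rewrite foxM raddfD /= int_liftM // deg_gr_of mul1r SM.
  by rewrite int_lift_gr_of deg_fox; ring.
move=> k; rewrite fox_gen /S big1 ?subr0 => [|j _]; last first.
  by rewrite magnus2_gen mulr0.
case: eqP => _; last exact: raddf0.
by rewrite -gr_of1 int_lift_gr_of bar_cocycle1_1.
Qed.

End MagnusCoefficients.

Section MagnusForm.
Variables (n : nat) (q1 q2 : 'FG_n -> rat).

Definition magnus_form (g : 'FG_n) : rat :=
  \sum_i (\sum_j q1 (fg_gen j) * magnus g [:: j; i]) * q2 (fg_gen i).

Hypotheses (q1M : is_bar_cocycle1 q1) (q2M : is_bar_cocycle1 q2).

(** The cross terms of [magnusM2] factor, because a homomorphism is the combination of exponent sums
    given by its values on generators. *)
Lemma magnus_formM g h :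
  magnus_form (g * h)%g = magnus_form g + magnus_form h + q1 g * q2 h.
Proof.
rewrite (fg_cocycleE g q1M) (fg_cocycleE h q2M) mulr_sumr -!big_split /=.
apply: eq_bigr => i _; rewrite [q2 _ * _]mulrC mulrA -!mulrDl.
congr (_ * _); rewrite mulr_suml -!big_split /=; apply: eq_bigr => j _.
by rewrite magnusM2 !mulrDr mulrA addrAC.
Qed.

Lemma magnus_form_prod m (s : 'I_m -> 'FG_n) (z : 'I_m -> int) :
  (forall l, q1 (s l) = 0 /\ q2 (s l) = 0) ->
  magnus_form (\prod_(l < m) expgz (s l) (z l))%g =
  \sum_(l < m) (z l)%:~R * magnus_form (s l).
Proof.
apply: (@local_morph_prod_expgz _ (fun g => q1 g = 0 /\ q2 g = 0)).
- by split; apply: bar_cocycle1_1.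
- by move=> g h [g1 g2] [h1 h2]; rewrite q1M q2M g1 g2 h1 h2 addr0.
- move=> g [g1 g2]; split.
    by apply: (addrI (q1 g)); rewrite -q1M mulgV bar_cocycle1_1 // g1 addr0.
  by apply: (addrI (q2 g)); rewrite -q2M mulgV bar_cocycle1_1 // g2 addr0.
by move=> g h [g1 _] _; rewrite magnus_formM g1 mul0r addr0.
Qed.

End MagnusForm.

Lemma cell_d2E n m (r : 'I_m -> 'FG_n) : cell_d2 r = exponent_matrix r.
Proof. by apply/matrixP => k i; rewrite !mxE deg_fox. Qed.

Lemma cell_d1E n : cell_d1 n = 0.
Proof. by apply/matrixP => i j; rewrite !mxE deg_gr_of_sub1. Qed.

Lemma exponent_matrix_prod n m (r w : 'I_m -> 'FG_n) (C : 'M[int]_m) :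
  (forall k, w k = (\prod_(l < m) expgz (r l) (C l k))%g) ->
  exponent_matrix w = (map_mx intr C)^T *m exponent_matrix r.
Proof.
move=> def_w; apply/matrixP => k i; rewrite !mxE def_w.
rewrite (@local_morph_prod_expgz _ (fun=> True) (exponent_sum i)) //.
  by apply: eq_bigr => l _; rewrite !mxE.
by move=> g h _ _; apply: exponent_sumM.
Qed.

(** * Existence of a chain map *)

Section RowComb.
Variables (R : nzRingType) (M : lmodType R) (n : nat) (e : 'I_n -> M).

Definition row_comb (x : 'rV[R]_n) : M := \sum_i x 0 i *: e i.

Lemma row_comb_is_linear : linear row_comb.
Proof.
move=> a x y; rewrite /row_comb scaler_sumr -big_split /=.
by apply: eq_bigr => i _; rewrite !mxE scalerDl scalerA.
Qed.

HB.instance Definition _ := GRing.isLinear.Build R 'rV[R]_n M *:%R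
  row_comb row_comb_is_linear.

End RowComb.

Section BarChainMap.
Variables (n m : nat) (G : groupType).
Variables (phi : {multiplicative 'FG_n -> G}) (r : 'I_m -> 'FG_n).
Local Notation ZG := (grpring G).

(** The image of the lifted path of [g] in the universal cover when each edge e_i is sent to
    [phi x_i]. *)
Definition fox_bar_chain (g : 'FG_n) : {freeg G / ZG} :=
  \sum_i grpring_map phi (fox i g) *: << phi (fg_gen i) >>.

Lemma fox_bar_chainM g h : fox_bar_chain (g * h)%g =
  fox_bar_chain g + gr_of (phi g) *: fox_bar_chain h.
Proof.
rewrite /fox_bar_chain scaler_sumr -big_split /=; apply: eq_bigr => i _.
by rewrite foxM raddfD /= grpring_mapM grpring_mapU scalerDl scalerA.
Qed.

Lemma bar_d2U (g h : G) : bar_d2 (<< (g, h) >> : {freeg (G * G) / ZG}) =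
  gr_of g *: << h >> - << (g * h)%g >> + << g >>.
Proof. by rewrite /bar_d2 liftU scale1r. Qed.

(** The bar resolution is not normalized: [1] is a nonzero chain, and [1|1] serves to remove it. *)
Lemma bar_d2_11 : bar_d2 (<< (1%g, 1%g) >> : {freeg (G * G) / ZG}) = << 1%g >>.
Proof. by rewrite bar_d2U mulg1 gr_of1 scale1r subrr add0r. Qed.

(** The chain [phi g] obeys the same crossed product rule as [fox_bar_chain], up to the boundary of
    [phi g|phi h]. For a relator this yields the filling that defines [T] on its 2-cell. *)
Lemma fox_bar_chain_homologous g :
  exists x, bar_d2 x = fox_bar_chain g - << phi g >>.
Proof.
have fox1 : fox_bar_chain 1%g = 0.
  by rewrite /fox_bar_chain big1 // => i _; rewrite raddf0 scale0r.
elim/fg_ind: g => [|i|g h [x dx] [y dy]|g [x dx]].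
- exists (- << (1%g, 1%g) >>).
  by rewrite raddfN /= bar_d2_11 fox1 multiplicative1 add0r.
- exists 0; rewrite raddf0 /fox_bar_chain (bigD1 i) //= fox_gen eqxx.
  rewrite grpring_map1 scale1r big1 ?addr0 ?subrr // => j ne_ji.
  by rewrite fox_gen eq_sym (negPf ne_ji) raddf0 scale0r.
- exists (x + gr_of (phi g) *: y + << (phi g, phi h) >>).
  rewrite !raddfD /= linearZ /= dx dy bar_d2U fox_bar_chainM gmulfM scalerBr.
  set a := fox_bar_chain g; set b := _ *: fox_bar_chain h.
  set s := << phi g >>; set t := _ *: << _ >>; set u := << _ >>.
  by rewrite [t - u + s]addrC addrACA subrK [b - t + _]addrA subrK addrA.
(* As g^-1 g has zero chain, the chain of g^-1 is -g^-1 times that of g. The boundary of [g^-1|g]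
   trades g^-1[g] for [1] - [g^-1], and [1|1] cancels [1]. *)
exists (- (gr_of (phi g^-1%g) *: x) - << (phi g^-1%g, phi g) >>
        - << (1%g, 1%g) >>).
rewrite !raddfD !raddfN /= linearZ /= dx bar_d2_11 bar_d2U -gmulfM mulVg.
rewrite multiplicative1 scalerBr.
have : fox_bar_chain (g^-1 * g)%g = 0 by rewrite mulVg.
rewrite fox_bar_chainM => /eqP; rewrite addr_eq0 => /eqP ->.
set a := _ *: fox_bar_chain g; set t := _ *: << phi g >>.
set u := << 1%g >>; set s := << phi _ >>.
rewrite !opprD !opprK [- t + u]addrC [u - t - s]addrAC.
rewrite [u - s - t]addrAC -[u - t - s]addrA [u + _]addrC [_ + (_ + u)]addrA.
by rewrite addrK addrA addrK.
Qed.

Lemma bar_chain_map_inhabited :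
  (forall k, phi (r k) = 1%g) -> inhabited (bar_chain_map phi r).
Proof.
move=> phi_r.
have /choice[tau dtau] (k : 'I_m) : exists x, bar_d2 x = fox_bar_chain (r k).
  have [x dx] := fox_bar_chain_homologous (r k).
  exists (x + << (1%g, 1%g) >>).
  by rewrite raddfD /= dx bar_d2_11 phi_r subrK.
have aug (x : 'rV[ZG]_1) :
    deg (row_comb (fun=> 1 : ZG^o) x : ZG) = deg (x 0 0 : ZG).
  by rewrite /row_comb big_ord1 [_ *: _]mulr1.
have d1 x : bar_d1 (row_comb (fun i => << phi (fg_gen i) >>) x) =
    row_comb (fun=> 1 : ZG^o) (x *m cover_d1 phi).
  rewrite /row_comb raddf_sum big_ord1 /= [RHS]mulr1 mxE.
  apply: eq_bigr => i _; rewrite linearZ /= !mxE /bar_d1 liftU scale1r.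
  by rewrite (raddfB (grpring_map phi)) /= grpring_mapU grpring_map1.
have d2 x : bar_d2 (row_comb tau x) =
    row_comb (fun i => << phi (fg_gen i) >>) (x *m cover_d2 phi r).
  rewrite mulmx_sum_row [in LHS]/row_comb !raddf_sum /=.
  apply: eq_bigr => k _; rewrite !linearZ /= dtau; congr (_ *: _).
  by apply: eq_bigr => i _; rewrite !mxE.
exact: (inhabits (BarChainMap aug d1 d2)).
Qed.

End BarChainMap.

(** * Homology of the echelon presentation *)

Section Echelon.
Variables (m n b : nat) (A : 'M[rat]_(m, n)) (c : 'I_b -> 'I_n).

Lemma is_pivot_inj k i j : is_pivot A k i -> is_pivot A k j -> i = j.
Proof.
move=> [Ai Ai0] [Aj Aj0]; apply: val_inj.
by case: (ltngtP i j) => // [/Aj0|/Ai0].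
Qed.

Lemma exists_pivot k i : A k i != 0 -> exists2 j, is_pivot A k j & (j <= i)%N.
Proof.
move=> Aki; case: (@arg_minnP _ i (fun j => A k j != 0) (@nat_of_ord n) Aki).
move=> j Aj minj; exists j; last exact: minj.
split; first exact/eqP.
move=> l lt_lj; apply/eqP; apply: contraLR lt_lj.
by rewrite -leqNgt; apply: minj.
Qed.

Hypothesis A_echelon : row_echelon A.

(** A nonzero entry would put the pivot of row [k'] at or before column [i], whereas it must lie
    strictly after the pivot of row [k]. *)
Lemma row_echelon_below (k k' : 'I_m) i :
  is_pivot A k i -> (k < k')%N -> A k' i = 0.
Proof.
move=> piv_i lt_kk'; apply/eqP; apply: contraT.
move=> /exists_pivot[i' piv_i' le_i'i].
have [j piv_j lt_ji'] := A_echelon lt_kk' piv_i'.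
by move: lt_ji'; rewrite -(is_pivot_inj piv_i piv_j) ltnNge le_i'i.
Qed.

Hypothesis c_nonpivot : enumerates_nonpivots A c.

Let pivot_row k := `[< exists i, is_pivot A k i >].

Lemma card_ord_lt (k : 'I_m) : #|[set j : 'I_m | (j < k)%N]| = k.
Proof.
rewrite -sum1dep_card (big_ord_narrow (ltnW (ltn_ord k))) /=.
by rewrite sum1_card card_ord.
Qed.

(** Rows with a pivot correspond bijectively to pivot columns, which form the complement of the [b]
    values of [c]. *)
Lemma card_pivot_rows : #|[set k | pivot_row k]| = (n - b)%N.
Proof.
have [c_incr c_np] := c_nonpivot.
have c_inj : injective c.
  move=> i j eq_c; apply: val_inj; case: (ltngtP i j) => // /c_incr.
    by rewrite eq_c ltnn.
  by rewrite eq_c ltnn.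
pose piv k := [pick i | `[< is_pivot A k i >]].
have pivE k i : is_pivot A k i -> piv k = Some i.
  rewrite /piv; case: pickP => [j /asboolP piv_j|none] piv_i.
    by rewrite (is_pivot_inj piv_i piv_j).
  by have /asboolP := piv_i; rewrite none.
have <- : #|~: [set c j | j in 'I_b]| = (n - b)%N.
  by rewrite cardsCs setCK card_ord card_imset // card_ord.
have piv_inj : {in [set k | pivot_row k] &, injective piv}.
  move=> k k'; rewrite !inE => /asboolP[i piv_i] /asboolP[i' piv_i'].
  rewrite (pivE _ _ piv_i) (pivE _ _ piv_i') => -[eq_i].
  rewrite -{i'}eq_i in piv_i'.
  apply: val_inj; case: (ltngtP k k') => // lt_k.
    by case: piv_i' => + _; rewrite (row_echelon_below piv_i lt_k).
  by case: piv_i => + _; rewrite (row_echelon_below piv_i' lt_k).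
have Some_inj : injective (@Some 'I_n) by move=> ? ? [].
rewrite -(card_in_imset piv_inj) -(card_imset _ Some_inj).
apply: eq_card => o; apply/imsetP/imsetP => [[k]|[i]].
  rewrite inE => /asboolP[i piv_i] ->; exists i; last exact: pivE.
  rewrite inE; apply/imsetP => -[j _ def_i].
  by case: (c_np i) => /(_ (ex_intro _ j (esym def_i))) []; exists k.
rewrite inE => /imsetP np_i ->.
have [k piv_k] : is_pivot_column A i.
  apply: contrapT => /(proj2 (c_np i))[j def_i].
  by case: np_i; exists j.
by exists k; rewrite ?(pivE _ _ piv_k) // inE; apply/asboolP; exists i.
Qed.

(** In echelon form the pivot rows are an initial segment, so their number determines them. *)
Lemma pivot_rowE k : pivot_row k = (k < n - b)%N.
Proof.
have down (k1 k2 : 'I_m) : (k1 <= k2)%N -> pivot_row k2 -> pivot_row k1.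
  rewrite leq_eqVlt => /orP[/eqP/val_inj->//|lt_k] /asboolP[i piv_i].
  by apply/asboolP; have [j piv_j _] := A_echelon lt_k piv_i; exists j.
rewrite -card_pivot_rows; apply/idP/idP => [piv_k|].
  rewrite -[X in (X < _)%N]card_ord_lt.
  apply: proper_card; apply/properP; split.
    by apply/subsetP => j; rewrite !inE => /ltnW/down; apply.
  by exists k; rewrite !inE ?ltnn.
apply: contraLR => npiv_k; rewrite -leqNgt -[X in (_ <= X)%N]card_ord_lt.
apply/subset_leq_card/subsetP => j; rewrite !inE; apply: contraLR.
by rewrite -leqNgt => /down le_kj; apply: contra npiv_k.
Qed.

Lemma echelon_zero_row (k : 'I_m) : (n - b <= k)%N -> row k A = 0.
Proof.
rewrite leqNgt -pivot_rowE => /asboolP npiv; apply/rowP => i; rewrite !mxE.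
apply/eqP; apply: contraT => /exists_pivot[j piv_j _].
by case: npiv; exists j.
Qed.

(** Induction on [k], reading the pivot column of row [k]: lower rows vanish there and earlier
    coordinates of [v] are already zero. *)
Lemma echelon_kernel (v : 'rV[rat]_m) :
  v *m A = 0 -> forall k : 'I_m, (k < n - b)%N -> v 0 k = 0.
Proof.
move=> vA0 k; have [N] := ubnP k; elim: N k => // N IHN k le_kN lt_k.
have := lt_k; rewrite -pivot_rowE => /asboolP[i piv_i].
have /rowP/(_ i) := vA0; rewrite !mxE (bigD1 k) //= big1 ?addr0 => [|j ne_jk].
  by move/eqP; rewrite mulf_eq0 => /orP[/eqP//|/eqP Aki0]; case: piv_i.
case: (ltngtP j k) => [lt_jk|lt_kj|/val_inj eq_jk].
- rewrite IHN ?mul0r //; [exact: leq_trans lt_jk _ | exact: ltn_trans lt_k].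
- by rewrite (row_echelon_below piv_i) ?mulr0.
by rewrite eq_jk eqxx in ne_jk.
Qed.

End Echelon.

Lemma sum_face n (r : 'I_n -> rat) : \sum_i r i *: face i = \row_i r i.
Proof. by rewrite [RHS]row_sum_delta; apply: eq_bigr => i _; rewrite mxE. Qed.

Lemma mem_cycles_d1 n (z : 'rV[rat]_n) : z \in cycles (cell_d1 n).
Proof. by rewrite mem_cycles cell_d1E mulmx0. Qed.

Lemma mem_cocycles_d3 m (x : 'rV[rat]_m) : x \in cycles (cell_d3 m)^T.
Proof. by rewrite mem_cycles trmx0 mulmx0. Qed.

Lemma mulmx_tr_edge n (a : 'rV[rat]_n) s : (a *m (edge s)^T) 0 0 = a 0 s.
Proof. by rewrite trmx_delta -colE !mxE. Qed.

Lemma kronecker1_edge n m (r : 'I_m -> 'FG_n) (a : 'rV[rat]_n) s :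
  a *m (cell_d2 r)^T = 0 ->
  kronecker1 (H1_class r a) (H_1_class r (edge s)) = a 0 s.
Proof.
move=> cyc_a; rewrite /kronecker1 kronecker_cls ?mem_cycles_d1 //.
  exact: mulmx_tr_edge.
by rewrite mem_cycles cyc_a.
Qed.

(** * The edge basis of H_1 and the values of 1-cocycles *)

Section EdgeBasis.
Variables (n m b : nat) (w : 'I_m -> 'FG_n) (c : 'I_b -> 'I_n).
Hypothesis c_np : enumerates_nonpivots (exponent_matrix w) c.

Lemma H_1_class_row k : H_1_class w (row k (exponent_matrix w)) = 0.
Proof.
apply/eqP; rewrite hcls_eq0 ?mem_cycles_d1 //.
by apply/mem_boundariesP; exists (delta_mx 0 k); rewrite -rowE cell_d2E.
Qed.

(** Induction from the last column backwards: a row with pivot [s] is a boundary, so it expresses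
    the edge [s] through edges further right. *)
Lemma edge_span s : H_1_class w (edge s) \in <<H_1_basis w c>>%VS.
Proof.
have [N] := ubnP (n - s); elim: N s => // N IHN s le_sN.
have [[k [Aks Ak0]]|np] := EM (is_pivot_column (exponent_matrix w) s);
  last first.
  have [j <-] := proj2 (proj2 c_np s) np.
  by apply/memv_span/tnthP; exists j; rewrite tnth_mktuple.
have /eqP := H_1_class_row k; rewrite [row k _]row_sum_delta (bigD1 s) //=.
rewrite /H_1_class linearD linearZ /= addr_eq0 => /eqP Aks_edge.
have : row k (exponent_matrix w) 0 s *: H_1_class w (edge s)
    \in <<H_1_basis w c>>%VS.
  rewrite /H_1_class Aks_edge memvN linear_sum; apply: memv_suml => i ne_is.
  rewrite linearZ /=; case: (ltngtP i s) => [/Ak0 Aki0|lt_si|/val_inj eq_is].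
  - by rewrite mxE Aki0 scale0r mem0v.
  - apply/memvZ/IHN; rewrite -ltnS; apply: leq_trans le_sN.
    by rewrite ltnS ltn_sub2l.
  by rewrite eq_is eqxx in ne_is.
move/(memvZ (exponent_matrix w k s)^-1).
by rewrite [row _ _ _ _]mxE scalerA mulVf ?scale1r //; apply/eqP.
Qed.

(** The edge [s] minus its expansion in the basis is a boundary, and cocycles vanish on
    boundaries. *)
Lemma cocycle_proj_coord (a : 'rV[rat]_n) s : a *m (exponent_matrix w)^T = 0 ->
  a 0 s = \sum_j proj_coord w c s j * a 0 (c j).
Proof.
move=> a_cyc; pose e := edge s - \sum_j proj_coord w c s j *: edge (c j).
have : H_1_class w e = 0.
  rewrite /H_1_class linearB linear_sum /=; apply/eqP; rewrite subr_eq0.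
  apply/eqP; rewrite [LHS](coord_span (edge_span s)); apply: eq_bigr => j _.
  by rewrite linearZ mxE /= (nth_map j) ?size_enum_ord // nth_ord_enum.
move/eqP; rewrite hcls_eq0 ?mem_cycles_d1 // => /mem_boundariesP[f def_e].
have : (a *m e^T) 0 0 = 0.
  by rewrite def_e trmx_mul mulmxA cell_d2E a_cyc mul0mx mxE.
rewrite /e linearB /= mulmxBr mxE mulmx_tr_edge [X in _ + X]mxE.
move/eqP; rewrite subr_eq0 => /eqP ->.
rewrite linear_sum mulmx_sumr summxE; apply: eq_bigr => j _.
by rewrite linearZ /= -scalemxAr mxE mulmx_tr_edge.
Qed.

End EdgeBasis.

Lemma tuple2_sum (R : nmodType) (I : finType) (F : 2.-tuple I -> R) :
  \sum_t F t = \sum_i \sum_j F [tuple i; j].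
Proof.
rewrite pair_bigA /= (reindex (fun p : I * I => [tuple p.1; p.2])) //=.
exists (fun t => (tnth t 0, tnth t 1)) => [[i j] _ //|t _].
by apply: val_inj; case: t => [[|x [|y [|z s]]] //= sz].
Qed.

Lemma kappa2E n m b (w : 'I_m -> 'FG_n) (c : 'I_b -> 'I_n) g i j :
  kappa w c g [:: i; j] =
  \sum_s \sum_t
    magnus g [:: s; t] * (proj_coord w c s i * proj_coord w c t j).
Proof.
rewrite /kappa /tensor_map /= tuple2_sum; apply: eq_bigr => s _.
apply: eq_bigr => t _; rewrite /= !big_ord_recl big_ord0 mulr1.
by rewrite !(tnth_nth s, tnth_nth i) /=.
Qed.

(** * The cycles gamma_l and the detection of classes in H^2 *)

Section HomologyOfEchelon.
Variables (n m b : nat) (r w : 'I_m -> 'FG_n).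
Variables (C : 'M[int]_m) (c : 'I_b -> 'I_n).
Hypothesis ech : echelon_approximation r C w.
Hypothesis c_np : enumerates_nonpivots (exponent_matrix w) c.

Let CQ : 'M[rat]_m := map_mx intr C.
Let gamma l : 'rV[rat]_m := \sum_(i < m) (C i l)%:~R *: face i.

Lemma echelon_d2 : exponent_matrix w = CQ^T *m cell_d2 r.
Proof.
by case: ech => _ def_w _; rewrite cell_d2E; apply: exponent_matrix_prod.
Qed.

Lemma gammaE l : gamma l = row l CQ^T.
Proof. by rewrite /gamma sum_face; apply/rowP => i; rewrite !mxE. Qed.

(** The boundary of gamma_l is row [l] of the exponent matrix of [w], which is zero from the rank n
    - b on. *)
Lemma gamma_d2 (l : 'I_m) : (n - b <= l)%N -> gamma l *m cell_d2 r = 0.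
Proof.
move=> le_l; rewrite gammaE -row_mul -echelon_d2.
by case: ech => _ _ e; apply: (echelon_zero_row e c_np).
Qed.

Lemma kronecker2_gamma (x : 'rV[rat]_m) (l : 'I_m) : (n - b <= l)%N ->
  kronecker2 (H2_class r x) (H_2_class r (gamma l)) = (x *m (gamma l)^T) 0 0.
Proof.
move=> le_l; rewrite /kronecker2 kronecker_cls ?mem_cocycles_d3 //.
by rewrite mem_cycles gamma_d2.
Qed.

(** Since [C] is invertible, [echelon_kernel] writes every 2-cycle through the gamma_l with l >= n -
    b. So [x] kills all cycles, and by duality it is a coboundary. *)
Lemma H2_class_eq0 (x : 'rV[rat]_m) :
  (forall l : 'I_m, (n - b <= l)%N -> (x *m (gamma l)^T) 0 0 = 0) ->
  H2_class r x = 0.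
Proof.
move=> x_gamma; have [Cunit _ e] := ech.
have CQunit : CQ^T \in unitmx.
  by rewrite unitmx_tr unitmxE det_map_mx rmorph_unit // -unitmxE.
have ortho (z : 'rV[rat]_m) : z *m cell_d2 r = 0 -> (x *m z^T) 0 0 = 0.
  move=> dz; rewrite -[z](mulmxKV CQunit); set v := z *m _.
  have vA : v *m exponent_matrix w = 0 by rewrite echelon_d2 mulmxA mulmxKV.
  rewrite [v *m _]mulmx_sum_row linear_sum mulmx_sumr summxE big1 // => l _.
  rewrite linearZ /= -scalemxAr mxE -gammaE.
  case: (ltnP l (n - b)) => [lt_l|le_l]; last by rewrite x_gamma // mulr0.
  by rewrite (echelon_kernel e c_np vA) // mul0r.
apply/eqP; rewrite hcls_eq0 ?mem_cocycles_d3 //; apply/mem_boundariesP.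
(* Double annihilator: the columns of the cokernel matrix of the transposed boundary are 2-cycles,
   so [x] kills them and lies in its row space. *)
suff /submxP[f def_x] : (x <= (cell_d2 r)^T)%MS by exists f.
rewrite submxE; apply/eqP/rowP => j; set K := cokermx _.
have := ortho (row j K^T); rewrite -row_mul.
have -> : K^T *m cell_d2 r = 0.
  by rewrite -[cell_d2 r]trmxK -trmx_mul mulmx_coker trmx0.
rewrite row0 => /(_ erefl); rewrite tr_row trmxK colE mulmxA -colE.
by rewrite mxE => ->; rewrite mxE.
Qed.

End HomologyOfEchelon.

(** * Cocycles of the complex as cocycles of the group, and existence of cup products *)

Section Descent.
Variables (n m : nat) (G : groupType).
Variables (phi : {multiplicative 'FG_n -> G}) (r : 'I_m -> 'FG_n).
Hypothesis phi_r : presents r phi.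

Lemma presents_rel k : phi (r k) = 1%g.
Proof. by case: phi_r => _ /(_ (r k)) [_ ->] //; apply: NCrel. Qed.

Lemma cocycle_comp (v : G -> rat) :
  is_bar_cocycle1 v -> is_bar_cocycle1 (v \o phi).
Proof. by move=> vM g h; rewrite /= gmulfM vM. Qed.

(** The homomorphism on the free group with values [a] on generators kills the relators, hence their
    normal closure, which is the kernel of [phi]; it therefore factors through [G]. *)
Lemma cocycle_descends (a : 'rV[rat]_n) : a *m (cell_d2 r)^T = 0 ->
  exists2 v : G -> rat, is_bar_cocycle1 v &
    forall i, v (phi (fg_gen i)) = a 0 i.
Proof.
move=> cyc_a; have [phi_surj ker_phi] := phi_r.
pose q g := \sum_i a 0 i * exponent_sum i g.
have qM : is_bar_cocycle1 q.
  move=> g h; rewrite /q -big_split; apply: eq_bigr => i _ /=.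
  by rewrite exponent_sumM mulrDr.
have q1 := bar_cocycle1_1 qM.
have qV g : q g^-1%g = - q g.
  by apply: (addrI (q g)); rewrite -qM mulgV q1 subrr.
have q_ker g : phi g = 1%g -> q g = 0.
  move/ker_phi; elim=> {g} [k||g h _ qg _ qh|g _ qg|g h _ qg] //.
  - have /rowP/(_ k) := cyc_a; rewrite !mxE => <-.
    by apply: eq_bigr => i _; rewrite cell_d2E !mxE.
  - by rewrite qM qg qh addr0.
  - by rewrite qV qg oppr0.
  by rewrite conjgE !qM qV qg add0r addNr.
have [s phiK] := choice phi_surj.
have q_phi g h : phi g = phi h -> q g = q h.
  move=> eq_gh; apply/eqP; rewrite -subr_eq0 -qV -qM; apply/eqP/q_ker.
  by rewrite gmulfM multiplicativeV eq_gh mulgV.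
exists (q \o s) => [y z|i] /=.
  by rewrite -qM; apply: q_phi; rewrite gmulfM !phiK.
rewrite (q_phi _ (fg_gen i)) ?phiK // /q (bigD1 i) //= exponent_sum_gen eqxx.
rewrite mulr1 big1 ?addr0 // => j ne_ji.
by rewrite exponent_sum_gen (negPf ne_ji) mulr0.
Qed.

Lemma pullback1_cocycle (T : bar_chain_map phi r) v :
  is_bar_cocycle1 v -> pullback1 T v *m (cell_d2 r)^T = 0.
Proof.
move=> vM; apply/rowP => k; rewrite mxE [RHS]mxE.
have vr0 : (v \o phi) (r k) = 0 by rewrite /= presents_rel bar_cocycle1_1.
rewrite -[RHS]vr0 (fg_cocycleE (r k) (cocycle_comp vM)); apply: eq_bigr => i _.
by rewrite pullback1E // cell_d2E !mxE.
Qed.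

(** [cup] is a choice with default 0; a chain map and descended cocycles exist, so the chosen class
    is a genuine cup product. *)
Lemma is_cup_cup (u1 u2 : H1 r) : is_cup phi u1 u2 (cup phi u1 u2).
Proof.
suff [x cup_x] : exists x, is_cup phi u1 u2 x.
  exact: (@classical_sets.xgetI _ 0 (is_cup phi u1 u2) x cup_x).
have [T] := bar_chain_map_inhabited presents_rel.
have cyc (u : H1 r) : vsval u *m (cell_d2 r)^T = 0.
  by have := hcls_cycle u; rewrite mem_cycles => /eqP.
have [v1 v1M v1E] := cocycle_descends (cyc u1).
have [v2 v2M v2E] := cocycle_descends (cyc u2).
exists (H2_class r (pullback2 T (fun p => v1 p.1 * v2 p.2))), T, v1, v2.
split=> //; rewrite /H1_class -[RHS]hcls_val; congr (hcls _ _ _);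
  apply/rowP => i.
  by rewrite pullback1E.
by rewrite pullback1E.
Qed.

End Descent.

(** * The cup product evaluated on the cycles gamma_l *)

Theorem theorem1p1 (n m : nat) (G : groupType)
    (phi : {multiplicative 'FG_n -> G}) (r : 'I_m -> 'FG_n) (b : nat)
    (C : 'M[int]_m) (w : 'I_m -> 'FG_n) (c : 'I_b -> 'I_n)
    (u : 'I_b -> H1 r) (beta : 'I_m -> H2 r) :
  presents r phi ->
  is_betti1 G b ->
  echelon_approximation r C w ->
  enumerates_nonpivots (exponent_matrix w) c ->
  (forall i j : 'I_b,
     kronecker1 (u i) (H_1_class r (edge (c j))) = (i == j)%:R) ->
  (* rows are numbered from 0: k ranges over n - b, .., m - 1 *)
  (forall k l : 'I_m, (n - b <= k)%N -> (n - b <= l)%N ->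
     kronecker2 (beta k)
       (H_2_class r (\sum_(i < m) (C i l)%:~R *: face i)) = (k == l)%:R) ->
  forall i j : 'I_b,
    cup phi (u i) (u j) =
    \sum_(k < m | (n - b <= k)%N) kappa w c (w k) [:: i; j] *: beta k.
Proof.
move=> phi_r _ ech c_np u_dual beta_dual i j.
have [T [v1 [v2 [[v1M v2M] u1E u2E <-]]]] := is_cup_cup phi_r (u i) (u j).
(* Duality fixes the cocycle on non-pivot edges, and [cocycle_proj_coord] extends this to all
   generators. *)
have dual v (k : 'I_b) s : is_bar_cocycle1 v ->
    H1_class r (pullback1 T v) = u k ->
    v (phi (fg_gen s)) = proj_coord w c s k.
  move=> vM uE; have cyc := pullback1_cocycle phi_r T vM.
  rewrite -(pullback1E T) // (cocycle_proj_coord c_np); last first.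
    by rewrite (echelon_d2 ech) trmx_mul mulmxA cyc mul0mx.
  rewrite (bigD1 k) //= -(kronecker1_edge _ cyc) uE u_dual eqxx mulr1.
  rewrite big1 ?addr0 // => l ne_lk.
  by rewrite -(kronecker1_edge _ cyc) uE u_dual eq_sym (negPf ne_lk) mulr0.
have H2_val (x : H2 r) : H2_class r (vsval x) = x by apply: hcls_val.
(* Both sides become classes of explicit cochains, so that their difference can be tested on the
   gamma_l. *)
have -> : \sum_(k < m | (n - b <= k)%N) kappa w c (w k) [:: i; j] *: beta k =
    H2_class r (\sum_(k < m | (n - b <= k)%N)
      kappa w c (w k) [:: i; j] *: vsval (beta k)).
  rewrite /H2_class linear_sum; apply: eq_bigr => k _.
  by rewrite linearZ /= -/(H2_class r _) H2_val.
apply/eqP; rewrite -subr_eq0 /H2_class -linearB; apply/eqP.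
apply: (H2_class_eq0 ech c_np) => l le_l; rewrite mulmxBl mxE [X in _ + X]mxE.
set gamma := \sum_(_ < m) _.
have beta_gamma (k : 'I_m) : (n - b <= k)%N ->
    (vsval (beta k) *m gamma^T) 0 0 = (k == l)%:R.
  by move=> le_k; rewrite -(kronecker2_gamma ech c_np _ le_l) H2_val beta_dual.
have -> : ((\sum_(k < m | (n - b <= k)%N)
    kappa w c (w k) [:: i; j] *: vsval (beta k)) *m gamma^T) 0 0 =
    kappa w c (w l) [:: i; j].
  rewrite mulmx_suml summxE (bigD1 l) //= -scalemxAl mxE beta_gamma // eqxx.
  rewrite mulr1 big1 ?addr0 // => k /andP[le_k ne_kl].
  by rewrite -scalemxAl mxE beta_gamma // (negPf ne_kl) mulr0.
apply/eqP; rewrite subr_eq0; apply/eqP.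
(* The coboundary term of [pullback2E] vanishes on the cycle gamma_l. *)
rewrite pullback2E // mulmxDl -mulmxA -trmx_mul (gamma_d2 ech c_np le_l).
rewrite trmx0 mulmx0 addr0 kappa2E.
have q1M := cocycle_comp phi v1M; have q2M := cocycle_comp phi v2M.
(* Relators die in [G], so both cocycles vanish on them and the form is additive on the product that
   defines w_l. *)
transitivity (magnus_form (v1 \o phi) (v2 \o phi) (w l)).
  have [_ -> _] := ech; rewrite magnus_form_prod // => [|k]; last first.
    by rewrite /= (presents_rel phi_r) !bar_cocycle1_1.
  rewrite /gamma sum_face mxE; apply: eq_bigr => k _; rewrite !mxE mulrC.
  by congr (_ * _); apply: eq_bigr => t _; rewrite int_lift_fox.
rewrite exchange_big; apply: eq_bigr => t _; rewrite mulr_suml.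
apply: eq_bigr => s _ /=.
by rewrite (dual _ i s) // (dual _ j t) //; ring.
Qed.
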